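(* Suppose $E$ and $F$ are Dedekind complete Riesz spaces. The following are equivalent. (1) $E_x \bar{\otimes} F_y$ is Dedekind complete for every $x \in E^+$ and $y \in F^+$. (2) [$E_x$ is finite dimensional for every $x \in E^+$] or [$F_y$ is finite dimensional for every $y \in F^+$]. (3) $E \cong c_{00}(I)$ for a set $I \subseteq E$ or $F \cong c_{00}(J)$ for a set $J \subseteq F$. (4) $E\bar{\otimes}F \cong c_{00}(I,F)$ for a set $I \subseteq E$ or $E\bar{\otimes}F \cong c_{00}(J,E)$ for a set $J \subseteq F$. (5) $E\bar{\otimes}F$ is Dedekind complete.
   Context: A Riesz space is a real vector lattice; $E^+$ denotes the positive cone of $E$, and $\cong$ denotes Riesz isomorphism. An Archimedean Riesz space is Dedekind complete if every nonempty subset that is bounded above has a supremum. Principal ideal: for $f\in E$, $E_f=\{g\in E: |g|\le\lambda|f| \text{ for some } \lambda\in\mathbb{R}^+\}$, a Riesz space in its own right. Fremlin tensor product: for Archimedean Riesz spaces $E,F,G$, a Riesz bimorphism is a bilinear map $T:E\times F\to G$ such that $z\mapsto T(z,y)$, $E\to G$, and $z\mapsto T(x,z)$, $F\to G$, are Riesz homomorphisms for all $x\in E^+$, $y\in F^+$. The Archimedean Riesz space tensor product (Fremlin tensor product) $E\bar{\otimes}F$ is the Archimedean Riesz space, unique up to Riesz isomorphism, equipped with a Riesz bimorphism $\otimes:E\times F\to E\bar{\otimes}F$ such that for every Archimedean Riesz space $H$ and every Riesz bimorphism $\psi:E\times F\to H$ there is a unique Riesz homomorphism $T:E\bar{\otimes}F\to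 H$ with $T\circ\otimes=\psi$. For a nonempty set $I$ and an Archimedean Riesz space $G$, $c_{00}(I,G)$ is the Archimedean Riesz space (pointwise operations and order) of all maps $f:I\to G$ such that $\{x\in I: f(x)\ne 0\}$ is finite; $c_{00}(I)=c_{00}(I,\mathbb{R})$. *)

(* Defs.v *)
From HB Require Import structures.
From mathcomp Require Import all_boot all_order all_algebra.
From mathcomp Require Import generic_quotient.
From mathcomp Require Import all_classical reals.

Set Implicit Arguments.
Unset Strict Implicit.
Unset Printing Implicit Defensive.

Import Order.TTheory GRing.Theory Num.Theory.

Local Open Scope classical_set_scope.
Local Open Scope quotient_scope.
Local Open Scope ring_scope.

(* Order.Lattice is not a parent of Riesz: Hierarchy-Builder does not allow   *)
(* a structure joining it with GRing.Zmodule to be declared after             *)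
(* Num.RealDomain. The Order.Lattice instance is derived from rz_meet and     *)
(* rz_join instead.                                                           *)
HB.mixin Record Lmodule_isRiesz (R : realType) V
    of GRing.Lmodule R V & Num.POrderedZmodule V := {
  rz_meet : V -> V -> V;
  rz_join : V -> V -> V;
  rz_meetP : forall x y z : V, (x <= rz_meet y z) = (x <= y) && (x <= z);
  rz_joinP : forall x y z : V, (rz_join x y <= z) = (x <= z) && (y <= z);
  rzD2l : forall z x y : V, x <= y -> z + x <= z + y;
  rz_scale_ge0 : forall (a : R) (x : V), 0 <= a -> 0 <= x -> 0 <= a *: x
}.

#[short(type="rieszType")]
HB.structure Definition Riesz (R : realType) :=
  {V of GRing.Lmodule R V & Num.POrderedZmodule V & Lmodule_isRiesz R V}.

Arguments rzD2l {R s} z [x y].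
Arguments rz_scale_ge0 {R s} [a x].

#[non_forgetful_inheritance]
HB.instance Definition _ (R : realType) (V : rieszType R) :=
  Order.POrder_MeetJoin_isLattice.Build ring_display (Riesz.sort V)
    (@rz_meetP R V) (@rz_joinP R V).

HB.mixin Record Riesz_isArchimedean (R : realType) V of Riesz R V := {
  rz_arch : forall x y : V, 0 <= x -> (forall n, x *+ n <= y) -> x = 0
}.

#[short(type="archRieszType")]
HB.structure Definition ArchRiesz (R : realType) :=
  {V of Riesz R V & Riesz_isArchimedean R V}.

#[non_forgetful_inheritance]
HB.instance Definition _ (R : realType) (V : archRieszType R) :=
  Order.Lattice.copy (ArchRiesz.sort V) (Riesz.sort V).

Section RieszNotions.
Variable R : realType.

Definition rabs (E : rieszType R) (x : E) : E := Order.join x (- x).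

Definition dedekind_complete (E : rieszType R) : Prop :=
  forall A : set E, has_sup A -> supremums A !=set0.

Definition finite_dimensional (V : lmodType R) : Prop :=
  exists n, inhabited (Vector.axiom n V).

Definition riesz_hom (E F : rieszType R) (f : E -> F) : Prop :=
  [/\ linear f, Order.meet_morphism f & Order.join_morphism f].

Definition riesz_iso (E F : rieszType R) : Prop :=
  exists f : E -> F, riesz_hom f /\ bijective f.

Definition riesz_bimorphism (E F G : rieszType R) (T : E -> F -> G) : Prop :=
  [/\ forall y, linear (T^~ y), forall x, linear (T x),
      forall y, 0 <= y -> riesz_hom (T^~ y)
    & forall x, 0 <= x -> riesz_hom (T x)].

End RieszNotions.

Notation "E ≅ F" := (riesz_iso E F) (at level 70, no associativity).

Section RieszTheory.
Variables (R : realType) (E : rieszType R).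
Implicit Types x y z : E.

Lemma rz_leBr x y : (x <= y) = (0 <= y - x).
Proof.
apply/idP/idP => [/(rzD2l (- x))|/(rzD2l x)].
  by rewrite addNr addrC.
by rewrite addr0 addrC subrK.
Qed.

Lemma rz_leD x y z t : x <= y -> z <= t -> x + z <= y + t.
Proof.
move=> xy zt; apply: le_trans (rzD2l y zt).
by rewrite ![_ + z]addrC; exact: rzD2l.
Qed.

Lemma rz_leN x y : (- y <= - x) = (x <= y).
Proof. by rewrite [LHS]rz_leBr opprK addrC -rz_leBr. Qed.

Lemma rz_leZ (a : R) x y : 0 <= a -> x <= y -> a *: x <= a *: y.
Proof.
by move=> a0; rewrite rz_leBr => xy; rewrite rz_leBr -scalerBr rz_scale_ge0.
Qed.

Lemma rz_leZr (a b : R) x : 0 <= x -> a <= b -> a *: x <= b *: x.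
Proof.
move=> x0 ab; rewrite rz_leBr -scalerBl rz_scale_ge0//.
by rewrite subr_ge0.
Qed.

Lemma rabs_leP x z : reflect (x <= z /\ - z <= x) (rabs x <= z).
Proof. by rewrite /rabs leUx -(rz_leN (- x) z) opprK; apply: andP. Qed.

Lemma rabs_ge0 x : 0 <= rabs x.
Proof.
have [le1 le2] : x <= rabs x /\ - x <= rabs x by rewrite leUl leUr.
have := rz_leD le1 le2; rewrite subrr -mulr2n -scaler_nat.
have half0 : 0 <= 2^-1 :> R by rewrite invr_ge0.
move=> /(rz_scale_ge0 half0).
by rewrite scalerA mulVf ?pnatr_eq0// scale1r.
Qed.

End RieszTheory.

Section RealLine.
Variable R : realType.

HB.instance Definition _ := Order.POrder.on R^o.

Fact regular_minP (x y z : R^o) : (x <= Order.min y z) = (x <= y) && (x <= z).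
Proof. exact: le_min. Qed.

Fact regular_maxP (x y z : R^o) : (Order.max x y <= z) = (x <= z) && (y <= z).
Proof. exact: ge_max. Qed.

Fact regular_D2l (z x y : R^o) : x <= y -> z + x <= z + y.
Proof. by move=> xy; exact: lerD. Qed.

Fact regular_scale_ge0 (a : R) (x : R^o) : 0 <= a -> 0 <= x -> 0 <= a *: x.
Proof. exact: mulr_ge0. Qed.

HB.instance Definition _ :=
  Lmodule_isRiesz.Build R R^o regular_minP regular_maxP
    regular_D2l regular_scale_ge0.

Fact regular_arch (x y : R^o) : 0 <= x -> (forall n, x *+ n <= y) -> x = 0.
Proof.
move=> x0 xy; apply/eqP/negPn/negP => xn0.
have {xn0} {}x0 : (0 : R) < x by rewrite lt_neqAle eq_sym xn0.
have y0 : (0 : R) <= y / x by rewrite divr_ge0 ?(ltW x0)//; exact: (xy 0%N).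
have /= := archi_boundP y0; rewrite ltNge => /negP; apply.
by rewrite ler_pdivlMr// mulr_natl; exact: xy.
Qed.

HB.instance Definition _ := Riesz_isArchimedean.Build R R^o regular_arch.

End RealLine.

Section PrincipalIdeal.
Variables (R : realType) (E : archRieszType R) (f : E).

Definition pideal_pred : {pred E} :=
  fun g => `[< exists2 l : R, 0 <= l & rabs g <= l *: rabs f >].

Record pideal := PIdeal { pideal_val :> E; _ : pideal_val \in pideal_pred }.

Fact pideal_submod_closed : submod_closed pideal_pred.
Proof.
split.
  by apply/asboolP; exists 0 => //; apply/rabs_leP; rewrite scale0r oppr0.
move=> a x y /asboolP[l l0 /rabs_leP[x1 x2]] /asboolP[m m0 /rabs_leP[y1 y2]].
apply/asboolP; exists (`|a| * l + m); first by rewrite addr_ge0// mulr_ge0.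
apply/rabs_leP; rewrite scalerDl opprD -scalerA.
have [a0|a0] := ger0P a.
  split; apply: rz_leD => //; first exact: rz_leZ.
  by rewrite -scalerN; exact: rz_leZ.
have na0 : 0 <= - a by rewrite oppr_ge0 ltW.
split; apply: rz_leD => //.
  by rewrite -(opprK (a *: x)) -scaleNr -scalerN rz_leZ// -rz_leN opprK.
by have := rz_leZ na0 x1; rewrite !scaleNr opprK rz_leN.
Qed.

HB.instance Definition _ :=
  GRing.isSubmodClosed.Build R E pideal_pred pideal_submod_closed.

Fact pideal_bound x y : x \in pideal_pred -> y \in pideal_pred ->
  exists z : E, [/\ exists2 l : R, 0 <= l & z = l *: rabs f,
    x <= z /\ - z <= x & y <= z /\ - z <= y].
Proof.
move=> /asboolP[l l0 xl] /asboolP[m m0 ym]; exists ((l + m) *: rabs f).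
split; first by exists (l + m) => //; exact: addr_ge0.
  apply/rabs_leP; apply: le_trans xl _.
  by apply: rz_leZr; [exact: rabs_ge0 | rewrite lerDl].
apply/rabs_leP; apply: le_trans ym _.
by apply: rz_leZr; [exact: rabs_ge0 | rewrite lerDr].
Qed.

Fact pideal_meet_subproof :
  {in pideal_pred &, forall x y : E, Order.meet x y \in pideal_pred}.
Proof.
move=> x y xI yI; have [z [[l l0 ->] [x1 x2] [y1 y2]]] :=
  pideal_bound xI yI.
apply/asboolP; exists l => //; apply/rabs_leP.
by rewrite lexI x2 y2; split => //; apply: le_trans x1; rewrite leIl.
Qed.

Fact pideal_join_subproof :
  {in pideal_pred &, forall x y : E, Order.join x y \in pideal_pred}.
Proof.
move=> x y xI yI; have [z [[l l0 ->] [x1 x2] [y1 y2]]] :=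
  pideal_bound xI yI.
apply/asboolP; exists l => //; apply/rabs_leP.
by rewrite leUx x1 y1; split => //; apply: le_trans x2 _; rewrite leUl.
Qed.

HB.instance Definition _ := [isSub for pideal_val].
HB.instance Definition _ := [Choice of pideal by <:].
HB.instance Definition _ := [SubChoice_isSubLmodule of pideal by <:].
HB.instance Definition _ :=
  [SubChoice_isSubPOrder of pideal by <: with ring_display].

Definition pideal_meet (x y : pideal) : pideal :=
  PIdeal (pideal_meet_subproof (valP x) (valP y)).
Definition pideal_join (x y : pideal) : pideal :=
  PIdeal (pideal_join_subproof (valP x) (valP y)).

Fact pideal_meetP (x y z : pideal) :
  (x <= pideal_meet y z) = (x <= y) && (x <= z).
Proof. exact: lexI. Qed.

Fact pideal_joinP (x y z : pideal) :
  (pideal_join x y <= z) = (x <= z) && (y <= z).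
Proof. exact: leUx. Qed.

Fact pideal_D2l (z x y : pideal) : x <= y -> z + x <= z + y.
Proof. exact: rzD2l. Qed.

Fact pideal_scale_ge0 (a : R) (x : pideal) : 0 <= a -> 0 <= x -> 0 <= a *: x.
Proof. exact: rz_scale_ge0. Qed.

HB.instance Definition _ :=
  Lmodule_isRiesz.Build R pideal pideal_meetP pideal_joinP
    pideal_D2l pideal_scale_ge0.

Fact pideal_arch (x y : pideal) : 0 <= x -> (forall n, x *+ n <= y) -> x = 0.
Proof.
move=> x0 xy; apply: val_inj => /=; apply: (@rz_arch _ _ _ (val y)) x0 _ => n.
by rewrite -raddfMn; exact: xy.
Qed.

HB.instance Definition _ := Riesz_isArchimedean.Build R pideal pideal_arch.

End PrincipalIdeal.

Section C00.
Variables (R : realType) (I : Type) (G : archRieszType R).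

(* I may be empty, in which case c00 I G is the zero space; this is needed to *)
(* represent E = 0 as c00 I R^o.                                              *)
Definition c00_pred : {pred I -> G} :=
  fun f => `[< finite_set [set i | f i != 0] >].

Record c00 := C00 { c00_val :> I -> G; _ : c00_val \in c00_pred }.

Fact c00_sub (f g h : I -> G) :
    (forall i, f i = 0 -> g i = 0 -> h i = 0) ->
  f \in c00_pred -> g \in c00_pred -> h \in c00_pred.
Proof.
move=> fgh /asboolP ff /asboolP fg; apply/asboolP.
apply: (@sub_finite_set _ _ ([set i | f i != 0] `|` [set i | g i != 0])).
  move=> i /= hi; have [fi|] := eqVneq (f i) 0; last by left.
  by right; apply: contra_neq hi; exact: fgh.
by rewrite finite_setU.
Qed.

Fact c00_submod_closed : submod_closed c00_pred.
Proof.
split; last first.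
  move=> a f g; apply: c00_sub => i fi gi.
  by rewrite fctE/= /GRing.scale/= fi gi scaler0 addr0.
apply/asboolP; rewrite [X in finite_set X](_ : _ = set0)//.
by apply/seteqP; split => // i /=; rewrite eqxx.
Qed.

HB.instance Definition _ :=
  GRing.isSubmodClosed.Build R (I -> G) c00_pred c00_submod_closed.

Fact c00_meet_subproof :
  {in c00_pred &, forall x y : I -> G, Order.meet x y \in c00_pred}.
Proof.
by move=> f g; apply: c00_sub => i fi gi; rewrite meetfE fi gi meetxx.
Qed.

Fact c00_join_subproof :
  {in c00_pred &, forall x y : I -> G, Order.join x y \in c00_pred}.
Proof.
by move=> f g; apply: c00_sub => i fi gi; rewrite joinfE fi gi joinxx.
Qed.

HB.instance Definition _ := [isSub for c00_val].
HB.instance Definition _ := [Choice of c00 by <:].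
HB.instance Definition _ := [SubChoice_isSubLmodule of c00 by <:].
HB.instance Definition _ :=
  [SubChoice_isSubPOrder of c00 by <: with ring_display].

Definition c00_meet (f g : c00) : c00 :=
  C00 (c00_meet_subproof (valP f) (valP g)).
Definition c00_join (f g : c00) : c00 :=
  C00 (c00_join_subproof (valP f) (valP g)).

Fact c00_meetP (f g h : c00) : (f <= c00_meet g h) = (f <= g) && (f <= h).
Proof. exact: lexI. Qed.

Fact c00_joinP (f g h : c00) : (c00_join f g <= h) = (f <= h) && (g <= h).
Proof. exact: leUx. Qed.

Fact c00_leP (f g : c00) : reflect (forall i, f i <= g i) (f <= g).
Proof. exact: lefP. Qed.

Fact c00_D2l (z x y : c00) : x <= y -> z + x <= z + y.
Proof. by move=> /c00_leP xy; apply/c00_leP => i; exact: rzD2l. Qed.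

Fact c00_scale_ge0 (a : R) (x : c00) : 0 <= a -> 0 <= x -> 0 <= a *: x.
Proof.
by move=> a0 /c00_leP x0; apply/c00_leP => i; exact: rz_scale_ge0 (x0 i).
Qed.

HB.instance Definition _ :=
  Lmodule_isRiesz.Build R c00 c00_meetP c00_joinP c00_D2l c00_scale_ge0.

Fact c00_arch (x y : c00) : 0 <= x -> (forall n, x *+ n <= y) -> x = 0.
Proof.
move=> /c00_leP x0 xy; apply: val_inj; apply/funext => i.
apply: (@rz_arch _ _ _ (y i)) (x0 i) _ => n.
have /c00_leP/(_ i) := xy n; congr (_ <= _).
have -> : (x *+ n : c00) i = ((val x) *+ n : I -> G) i by rewrite -raddfMn.
by elim: n => [|n IH]; rewrite ?mulr0n// !mulrS -IH.
Qed.

HB.instance Definition _ := Riesz_isArchimedean.Build R c00 c00_arch.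

End C00.

Record fremlin_tensor (R : realType) (E F : archRieszType R) := FremlinTensor {
  ft_space :> archRieszType R;
  ft_tens : E -> F -> ft_space;
  ft_bimorphism : riesz_bimorphism ft_tens;
  ft_universal : forall (H : archRieszType R) (psi : E -> F -> H),
    riesz_bimorphism psi ->
    exists! T : ft_space -> H,
      riesz_hom T /\ forall x y, T (ft_tens x y) = psi x y
}.

Lemma riesz_hom_comp (R : realType) (E F G : rieszType R)
    (g : F -> G) (f : E -> F) :
  riesz_hom g -> riesz_hom f -> riesz_hom (g \o f).
Proof.
move=> [gl gm gj] [fl fm fj].
by split=> [a x y|x y|x y] /=; rewrite ?fl ?gl ?fm ?gm ?fj ?gj.
Qed.

Lemma fremlin_tensor_unique (R : realType) (E F : archRieszType R)
  (T T' : fremlin_tensor E F) : T ≅ T'.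
Proof.
have endo (S : fremlin_tensor E F) (h : S -> S) : riesz_hom h ->
    (forall x y, h (ft_tens S x y) = ft_tens S x y) -> h = id.
  move=> hh hE; have [u [_ uniq]] := ft_universal S (ft_bimorphism S).
  rewrite -[LHS](uniq h)//; apply: uniq.
  by split=> //; split=> [a x y|x y|x y].
have [f [[fh fE] _]] := ft_universal T (ft_bimorphism T').
have [g [[gh gE] _]] := ft_universal T' (ft_bimorphism T).
exists f; split=> //; exists g => z.
  rewrite -[LHS]/((g \o f) z) (endo T (g \o f))//; first exact: riesz_hom_comp.
  by move=> x y /=; rewrite fE gE.
rewrite -[LHS]/((f \o g) z) (endo T' (f \o g))//; first exact: riesz_hom_comp.
by move=> x y /=; rewrite gE fE.
Qed.

(* Existence: formal Riesz terms over E x F, two terms being identified when  *)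
(* every Riesz bimorphism into an Archimedean Riesz space evaluates them to   *)
(* the same element. By fremlin_tensor_unique, nothing depends on this choice *)
(* of model up to Riesz isomorphism.                                          *)

Inductive rterm (E F A : Type) : Type :=
| TZero
| TTens of E & F
| TOpp of rterm E F A
| TScale of A & rterm E F A
| TAdd of rterm E F A & rterm E F A
| TMeet of rterm E F A & rterm E F A
| TJoin of rterm E F A & rterm E F A.

Arguments TZero {E F A}.
Arguments TTens {E F A}.

HB.instance Definition _ E F A := gen_eqMixin (rterm E F A).
HB.instance Definition _ E F A := gen_choiceMixin (rterm E F A).

Section Construction.
Variables (R : realType) (E F : archRieszType R).
Let term := rterm E F R.

Record bimorphism := Bimorphism {
  bim_cod : archRieszType R;
  bim_fun : E -> F -> bim_cod;
  bimP : riesz_bimorphism bim_fun }.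

Implicit Types (b : bimorphism) (t s : term).

Fixpoint teval b t : bim_cod b :=
  match t with
  | TZero => 0
  | TTens x y => bim_fun b x y
  | TOpp t => - teval b t
  | TScale a t => a *: teval b t
  | TAdd t s => teval b t + teval b s
  | TMeet t s => Order.meet (teval b t) (teval b s)
  | TJoin t s => Order.join (teval b t) (teval b s)
  end.

Definition tequiv : rel term :=
  fun t s => `[< forall b, teval b t = teval b s >].

Fact tequiv_refl : reflexive tequiv.
Proof. by move=> t; apply/asboolP. Qed.

Fact tequiv_sym : symmetric tequiv.
Proof. by move=> t s; apply/asboolP/asboolP => h b; rewrite h. Qed.

Fact tequiv_trans : transitive tequiv.
Proof.
by move=> t s u /asboolP st /asboolP tu; apply/asboolP => b; rewrite st tu.
Qed.

Canonical tequiv_equiv := EquivRel tequiv tequiv_refl tequiv_sym tequiv_trans.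

Definition tensq := {eq_quot tequiv}.
HB.instance Definition _ := Choice.on tensq.
HB.instance Definition _ := Quotient.on tensq.

Implicit Types x y z : tensq.

Definition tpi (t : term) : tensq := \pi t.
Definition qeval b x : bim_cod b := teval b (repr x).

Fact qevalE b t : qeval b (tpi t) = teval b t.
Proof.
have /eqmodP/asboolP : \pi_tensq (repr (tpi t)) = \pi_tensq t by rewrite reprK.
exact.
Qed.

Fact qeval_inj x y : (forall b, qeval b x = qeval b y) -> x = y.
Proof.
by move=> xy; rewrite -[x]reprK -[y]reprK; apply/eqmodP/asboolP.
Qed.

Definition tadd x y := tpi (TAdd (repr x) (repr y)).
Definition topp x := tpi (TOpp (repr x)).
Definition tscale a x := tpi (TScale a (repr x)).
Definition tmeet x y := tpi (TMeet (repr x) (repr y)).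
Definition tjoin x y := tpi (TJoin (repr x) (repr y)).
Definition tle : rel tensq :=
  fun x y => `[< forall b, qeval b x <= qeval b y >].

Let evE := (qevalE, (fun b x => erefl : teval b (repr x) = qeval b x)).

Fact taddA : associative tadd.
Proof.
by move=> x y z; apply: qeval_inj => b; rewrite !qevalE/= !evE/= addrA.
Qed.
Fact taddC : commutative tadd.
Proof. by move=> x y; apply: qeval_inj => b; rewrite !qevalE/= addrC. Qed.
Fact tadd0 : left_id (tpi TZero) tadd.
Proof. by move=> x; apply: qeval_inj => b; rewrite !qevalE/= !evE add0r. Qed.
Fact taddN : left_inverse (tpi TZero) topp tadd.
Proof. by move=> x; apply: qeval_inj => b; rewrite !qevalE/= !evE/= addNr. Qed.

HB.instance Definition _ :=
  GRing.isZmodule.Build tensq taddA taddC tadd0 taddN.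

Fact qevalD b x y : qeval b (x + y) = qeval b x + qeval b y.
Proof. exact: qevalE. Qed.

Fact tscaleA (a c : R) x : tscale a (tscale c x) = tscale (a * c) x.
Proof. by apply: qeval_inj => b; rewrite !qevalE/= !evE/= scalerA. Qed.
Fact tscale1 : left_id 1 tscale.
Proof. by move=> x; apply: qeval_inj => b; rewrite !qevalE/= scale1r. Qed.
Fact tscaleDr : right_distributive tscale +%R.
Proof.
move=> a x y; apply: qeval_inj => b.
by rewrite !qevalE/= !evE/= !evE scalerDr.
Qed.
Fact tscaleDl x : {morph tscale^~ x : a c / a + c}.
Proof.
move=> a c; apply: qeval_inj => b.
by rewrite !qevalE/= !evE/= scalerDl.
Qed.

HB.instance Definition _ :=
  GRing.Zmodule_isLmodule.Build R tensq tscaleA tscale1 tscaleDr tscaleDl.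

Fact qevalZ b a x : qeval b (a *: x) = a *: qeval b x.
Proof. exact: qevalE. Qed.

Fact tle_refl : reflexive tle.
Proof. by move=> x; apply/asboolP. Qed.
Fact tle_anti : antisymmetric tle.
Proof.
move=> x y /andP[/asboolP xy /asboolP yx]; apply: qeval_inj => b.
by apply: le_anti; rewrite xy yx.
Qed.
Fact tle_trans : transitive tle.
Proof.
move=> x y z /asboolP xy /asboolP yz; apply/asboolP => b.
exact: le_trans (xy b) (yz b).
Qed.

HB.instance Definition _ :=
  Order.Le_isPOrder.Build ring_display tensq tle_refl tle_anti tle_trans.

Fact tmeetP x y z : (x <= tmeet y z) = (x <= y) && (x <= z).
Proof.
apply/asboolP/andP => [h|[/asboolP xy /asboolP xz] b].
  by split; apply/asboolP => b; have := h b; rewrite qevalE/= lexI => /andP[].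
by rewrite qevalE/= lexI xy xz.
Qed.
Fact tjoinP x y z : (tjoin x y <= z) = (x <= z) && (y <= z).
Proof.
apply/asboolP/andP => [h|[/asboolP xy /asboolP xz] b].
  by split; apply/asboolP => b; have := h b; rewrite qevalE/= leUx => /andP[].
by rewrite qevalE/= leUx xy xz.
Qed.

Fact tensq_leP x y : reflect (forall b, qeval b x <= qeval b y) (x <= y).
Proof. exact: asboolP. Qed.

Fact tensq_D2l z x y : x <= y -> z + x <= z + y.
Proof.
move=> /tensq_leP xy; apply/tensq_leP => b; rewrite !qevalD.
exact: rzD2l (xy b).
Qed.

Fact qeval0 b : qeval b 0 = 0.
Proof. exact: qevalE. Qed.

Fact tensq_scale_ge0 (a : R) x : 0 <= a -> 0 <= x -> 0 <= a *: x.
Proof.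
move=> a0 /tensq_leP x0; apply/tensq_leP => b; have := x0 b.
by rewrite qevalZ !qeval0; exact: rz_scale_ge0.
Qed.

HB.instance Definition _ :=
  Lmodule_isRiesz.Build R tensq tmeetP tjoinP tensq_D2l tensq_scale_ge0.

Fact tensq_arch x y : 0 <= x -> (forall n, x *+ n <= y) -> x = 0.
Proof.
move=> /tensq_leP x0 xy; apply: qeval_inj => b; rewrite qeval0.
apply: (@rz_arch _ _ _ (qeval b y)) => [|n].
  by have := x0 b; rewrite qeval0.
have /tensq_leP/(_ b) := xy n; congr (_ <= _).
by elim: n => [|n IH]; rewrite ?mulr0n ?qeval0// !mulrS qevalD IH.
Qed.

HB.instance Definition _ := Riesz_isArchimedean.Build R tensq tensq_arch.

Fact qeval_hom b : riesz_hom (qeval b).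
Proof.
by split=> [a x y|x y|x y]; [rewrite qevalD qevalZ|exact: qevalE..].
Qed.

Definition tens (x : E) (y : F) : tensq := tpi (TTens x y).

Fact tens_bimorphism : riesz_bimorphism tens.
Proof.
have linl (y : F) : linear (tens^~ y).
  move=> a u v; apply: qeval_inj => b; rewrite qevalD qevalZ !qevalE/=.
  by have [h _ _ _] := bimP b; exact: h.
have linr (x : E) : linear (tens x).
  move=> a u v; apply: qeval_inj => b; rewrite qevalD qevalZ !qevalE/=.
  by have [_ h _ _] := bimP b; exact: h.
split=> // [y y0|x x0]; split=> // u v; apply: qeval_inj => b;
  rewrite [LHS]qevalE [RHS]qevalE/= !evE/=.
- by have [_ _ /(_ _ y0)[_ h _] _] := bimP b; exact: h.
- by have [_ _ /(_ _ y0)[_ _ h] _] := bimP b; exact: h.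
- by have [_ _ _ /(_ _ x0)[_ h _]] := bimP b; exact: h.
- by have [_ _ _ /(_ _ x0)[_ _ h]] := bimP b; exact: h.
Qed.

Fact tpiN t : tpi (TOpp t) = - tpi t.
Proof. by apply: qeval_inj => b; rewrite qevalE [RHS]qevalE/= !evE. Qed.
Fact tpiZ a t : tpi (TScale a t) = a *: tpi t.
Proof. by apply: qeval_inj => b; rewrite qevalE [RHS]qevalE/= !evE. Qed.
Fact tpiD t s : tpi (TAdd t s) = tpi t + tpi s.
Proof. by apply: qeval_inj => b; rewrite qevalE [RHS]qevalE/= !evE. Qed.
Fact tpiI t s : tpi (TMeet t s) = rz_meet (tpi t) (tpi s).
Proof. by apply: qeval_inj => b; rewrite qevalE [RHS]qevalE/= !evE. Qed.
Fact tpiU t s : tpi (TJoin t s) = rz_join (tpi t) (tpi s).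
Proof. by apply: qeval_inj => b; rewrite qevalE [RHS]qevalE/= !evE. Qed.

Fact tens_universal (H : archRieszType R) (psi : E -> F -> H) :
  riesz_bimorphism psi ->
  exists! T : tensq -> H,
    riesz_hom T /\ forall (x : E) (y : F), T (tens x y) = psi x y.
Proof.
move=> hpsi; pose b := Bimorphism hpsi; exists (qeval b); split.
  by split=> [|x y]; [exact: (qeval_hom b) | exact: (qevalE b)].
move=> T [[linT meetT joinT] Tpsi]; apply/funext => x.
have [L LE] : exists L : {linear tensq -> H}, T =1 L.
  pose L : {linear tensq -> H} :=
    HB.pack T (GRing.isLinear.Build R tensq H *:%R T linT).
  by exists L.
have -> : T x = T (tpi (repr x)) by rewrite /tpi reprK.
rewrite /qeval.
elim: (repr x) => /= [|u v|t ->|a t ->|t -> s ->|t -> s ->|t -> s ->].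
- by rewrite LE -[RHS]/(L 0) linear0.
- by rewrite -Tpsi.
- by rewrite tpiN !LE linearN.
- by rewrite tpiZ !LE linearZ.
- by rewrite tpiD !LE linearD.
- by rewrite tpiI; apply/esym/meetT.
- by rewrite tpiU; apply/esym/joinT.
Qed.

Definition fremlin : fremlin_tensor E F :=
  FremlinTensor tens_bimorphism tens_universal.

End Construction.

Notation "E ⊗ F" := (ft_space (fremlin E F)) (at level 40, left associativity).

(* Main.v *)
Require Import Defs.
From HB Require Import structures.
From mathcomp Require Import finmap.
From mathcomp Require Import all_boot all_order all_algebra.
From mathcomp Require Import generic_quotient.
From mathcomp Require Import all_classical reals.
From mathcomp Require Import lra zify.

(* Every condition is equivalent to the absence, in E or in F, of an infinite
   order bounded disjoint sequence of nonzero positive elements. If E has none,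
   every positive element of E is a finite combination of atoms, so that E is
   some c00(I); then c00(I, F) has the universal property of the tensor product,
   and it is Dedekind complete because F is.

   Conversely let e_n <= x in E and f_m <= y in F be two such sequences, and let s
   be the supremum of the e_n ⊗ f_m over a set A of pairs (n, m). Being a lattice
   term in finitely many elementary tensors, s can be evaluated at pairs (phi, psi)
   of real Riesz homomorphisms, and at points with phi_n(e_n) > 0 and
   psi_m(f_m) > 0 its value is positive exactly when (n, m) is in A. For fixed
   phi_n the value is a piecewise linear function of finitely many coordinates
   psi(y_j), so the number of sign patterns on N rows is polynomial in N; this
   contradicts the choice of an A having all 2^N patterns.

   Real homomorphisms need not exist on the whole of E, but maps satisfying any
   countably many of the defining conditions do, by a Rasiowa-Sikorski argument;
   this suffices for evaluating in a reduced power of the reals modulo a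
   countably complete filter, which is an Archimedean Riesz space. *)

Set Implicit Arguments.
Unset Strict Implicit.
Unset Printing Implicit Defensive.

Import Order.TTheory GRing.Theory Num.Theory.

Local Open Scope ring_scope.

(** * Riesz spaces *)

Section RieszBasics.
Variables (R : realType) (E : rieszType R).
Implicit Types x y z t : E.

Definition rpos x : E := Order.join x 0.

Definition rdisj x y : Prop := Order.meet x y = 0.

Lemma rz_leDl z x y : (z + x <= z + y) = (x <= y).
Proof. by rewrite [LHS]rz_leBr [RHS]rz_leBr opprD addrACA subrr add0r. Qed.

Lemma rz_leDr z x y : (x + z <= y + z) = (x <= y).
Proof. by rewrite ![_ + z]addrC rz_leDl. Qed.

Lemma rz_leBlr x y z : (x - y <= z) = (x <= z + y).
Proof. by rewrite -[LHS](rz_leDr y) subrK. Qed.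

Lemma rz_leBrr x y z : (x <= y - z) = (x + z <= y).
Proof. by rewrite -[LHS](rz_leDr z) subrK. Qed.

Lemma rz_leNl x y : (- x <= y) = (- y <= x).
Proof. by rewrite -[RHS]rz_leN opprK. Qed.

Lemma rz_addr_ge0 x y : 0 <= x -> 0 <= y -> 0 <= x + y.
Proof. by move=> x0 y0; rewrite -[0]addr0 rz_leD. Qed.

Lemma rz_ler_wDl x y : 0 <= y -> x <= y + x.
Proof. by move=> y0; rewrite -[leLHS]add0r rz_leDr. Qed.

Lemma rz_addmeet z x y : z + Order.meet x y = Order.meet (z + x) (z + y).
Proof.
apply: le_anti; rewrite lexI !rz_leDl leIl leIr /=.
by rewrite [leRHS]addrC -rz_leBlr lexI !rz_leBlr ![_ + z]addrC leIl leIr.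
Qed.

Lemma rz_addjoin z x y : z + Order.join x y = Order.join (z + x) (z + y).
Proof.
apply: le_anti; rewrite leUx !rz_leDl leUl leUr /= andbT.
by rewrite [leLHS]addrC -rz_leBrr leUx !rz_leBrr ![_ + z]addrC leUl leUr.
Qed.

Lemma rz_oppmeet x y : - Order.meet x y = Order.join (- x) (- y).
Proof.
apply: le_anti; rewrite leUx !rz_leN leIl leIr /= andbT rz_leNl lexI.
by rewrite (rz_leNl _ x) (rz_leNl _ y) leUl leUr.
Qed.

Lemma rz_meetjoin x y : x + y = Order.meet x y + Order.join x y.
Proof.
have /(congr1 (+%R (x + y))) := rz_oppmeet x y.
rewrite rz_addjoin addrK [x + y]addrC addrK [Order.join y _]joinC => <-.
by rewrite [RHS]addrC subrK addrC.
Qed.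

(** By [rz_meetjoin], both [y] and [z] lie below [m + x ∨ (y ∨ z) - x], hence so does their join.
    The same identity applied to [x] and [y ∨ z] then cancels [x ∨ (y ∨ z)]. *)
Lemma rz_meetUr x y z :
  Order.meet x (Order.join y z) = Order.join (Order.meet x y) (Order.meet x z).
Proof.
apply: le_anti; rewrite leUx !leI2 ?leUl ?leUr// /= ?andbT.
set m := Order.join (Order.meet x y) _.
have h (w : E) : Order.meet x w <= m -> w <= Order.join y z ->
    w <= m + Order.join x (Order.join y z) - x.
  move=> wm wyz; rewrite rz_leBrr [leLHS]addrC [leLHS]rz_meetjoin.
  by apply: rz_leD => //; apply: leU2.
have : Order.join y z <= m + Order.join x (Order.join y z) - x.
  by rewrite leUx !h// ?leUl ?leUr.
by rewrite rz_leBrr [leLHS]addrC [leLHS]rz_meetjoin rz_leDr.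
Qed.

Lemma rz_joinIl x y z :
  Order.join (Order.meet x y) z = Order.meet (Order.join x z) (Order.join y z).
Proof.
apply: le_anti; apply/andP; split.
  rewrite lexI !leUx !leUr (le_trans (leIl _ _) (leUl _ _)).
  by rewrite (le_trans (leIr _ _) (leUl _ _)).
rewrite rz_meetUr leUx (le_trans (leIr _ _) (leUr _ _)) andbT meetC.
rewrite rz_meetUr leUx [Order.meet y x]meetC leUl /=.
by rewrite (le_trans (leIr _ _) (leUr _ _)).
Qed.

Lemma rpos_ge0 x : 0 <= rpos x. Proof. exact: leUr. Qed.

Lemma le_rpos x : x <= rpos x. Proof. exact: leUl. Qed.

Lemma rpos_id x : 0 <= x -> rpos x = x.
Proof. by move=> x0; apply: le_anti; rewrite leUx lexx x0 leUl. Qed.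

Lemma rpos_le x y : x <= y -> rpos x <= rpos y.
Proof. by move=> xy; rewrite leU2. Qed.

Lemma rposN x : rpos (- x) = - Order.meet x 0.
Proof. by rewrite rz_oppmeet oppr0. Qed.

Lemma rposB x : rpos x - rpos (- x) = x.
Proof. by rewrite rposN opprK addrC -rz_meetjoin addr0. Qed.

(** As [x^+ = x^- + x], the meet equals [x^- + (x ∧ 0)], that is, [x^- - x^-]. *)
Lemma rpos_disj x : rdisj (rpos x) (rpos (- x)).
Proof.
have e : rpos x = rpos (- x) + x by rewrite -{3}(rposB x) addrC subrK.
rewrite /rdisj e -[X in Order.meet _ X]addr0 -rz_addmeet rposN.
exact: addNr.
Qed.

Lemma rdisjC x y : rdisj x y -> rdisj y x.
Proof. by rewrite /rdisj meetC. Qed.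

Lemma rdisj_joinE x y : rdisj x y -> Order.join x y = x + y.
Proof. by move=> d; rewrite rz_meetjoin d add0r. Qed.

Lemma rdisj_rposB x y : rdisj x y -> rpos (x - y) = x.
Proof.
move=> d; rewrite /rpos -[X in Order.join _ X](addNr y) [x - y]addrC.
by rewrite -rz_addjoin rdisj_joinE// addrC addrK.
Qed.

Lemma le_rdisj x y : 0 <= x -> 0 <= y -> Order.meet x y <= 0 -> rdisj x y.
Proof. by move=> x0 y0 h; apply: le_anti; rewrite h lexI x0. Qed.

Lemma rdisj_le x y x' y' : 0 <= x -> 0 <= y -> x <= x' -> y <= y' ->
  rdisj x' y' -> rdisj x y.
Proof.
by move=> x0 y0 xx yy d; apply: le_rdisj => //; rewrite -d leI2.
Qed.

Lemma rz_meetDl x y z : 0 <= x -> 0 <= y -> 0 <= z ->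
  Order.meet (x + y) z <= Order.meet x z + Order.meet y z.
Proof.
move=> x0 y0 z0; set m := Order.meet (x + y) z.
have mz (w : E) : 0 <= w -> m <= z + w.
  by move=> w0; rewrite addrC; apply: le_trans (rz_ler_wDl z w0); exact: leIr.
rewrite [leRHS]addrC -rz_leBlr lexI !rz_leBlr !rz_addmeet !lexI !mz//.
by rewrite [y + x]addrC [y + z]addrC mz// leIl.
Qed.

Lemma rdisjD x y z : 0 <= x -> 0 <= y -> 0 <= z ->
  rdisj x z -> rdisj y z -> rdisj (x + y) z.
Proof.
move=> x0 y0 z0 xz yz; apply: le_rdisj => //; first exact: rz_addr_ge0.
by apply: le_trans (rz_meetDl x0 y0 z0) _; rewrite xz yz addr0.
Qed.

Lemma rz_lescale (a : R) x y : 0 < a -> (a *: x <= a *: y) = (x <= y).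
Proof.
move=> a0; apply/idP/idP; last by apply: rz_leZ; exact: ltW.
move=> /(rz_leZ (ltW (_ : 0 < a^-1))); rewrite invr_gt0 => /(_ a0).
by rewrite !scalerA mulVf ?gt_eqF// !scale1r.
Qed.

Lemma rz_scalemeet (a : R) x y : 0 <= a ->
  a *: Order.meet x y = Order.meet (a *: x) (a *: y).
Proof.
rewrite le_eqVlt => /predU1P[<-|a0]; first by rewrite !scale0r meetxx.
apply: le_anti; rewrite lexI !rz_lescale// leIl leIr /=.
have e w : w = a *: (a^-1 *: w) by rewrite scalerA divff ?gt_eqF// scale1r.
rewrite [leLHS]e rz_lescale// lexI -(rz_lescale _ x a0) -(rz_lescale _ y a0).
by rewrite -!e leIl leIr.
Qed.

Lemma rz_scalepos (a : R) x : 0 <= a -> rpos (a *: x) = a *: rpos x.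
Proof.
move=> a0; have d : rdisj (a *: rpos x) (a *: rpos (- x)).
  by rewrite /rdisj -rz_scalemeet// rpos_disj scaler0.
by rewrite -[RHS](rdisj_rposB d) -scalerBr rposB.
Qed.

Lemma rdisj_scaler (a : R) x y : 0 <= a -> 0 <= x -> 0 <= y ->
  rdisj x y -> rdisj x (a *: y).
Proof.
move=> a0 x0 y0 d; have a10 : 0 <= 1 + a by rewrite addr_ge0.
apply: (@rdisj_le _ _ ((1 + a) *: x) ((1 + a) *: y)) => //.
- exact: rz_scale_ge0.
- by rewrite -[leLHS]scale1r rz_leZr// lerDl.
- by rewrite rz_leZr// lerDr.
- by rewrite /rdisj -rz_scalemeet// d scaler0.
Qed.

Lemma rdisj_scale (a b : R) x y : 0 <= a -> 0 <= b -> 0 <= x -> 0 <= y ->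
  rdisj x y -> rdisj (a *: x) (b *: y).
Proof.
move=> a0 b0 x0 y0 d; apply: rdisj_scaler => //; first exact: rz_scale_ge0.
by apply: rdisjC; apply: rdisj_scaler => //; exact: rdisjC.
Qed.

Lemma rz_sum_ge0 (I : Type) (s : seq I) (P : pred I) (f : I -> E) :
  (forall i, 0 <= f i) -> 0 <= \sum_(i <- s | P i) f i.
Proof. by move=> f0; elim/big_ind: _ => // x y; exact: rz_addr_ge0. Qed.

Lemma rdisj_sum (I : Type) (s : seq I) (f : I -> E) z :
  0 <= z -> (forall i, 0 <= f i) -> (forall i, rdisj (f i) z) ->
  rdisj (\sum_(i <- s) f i) z.
Proof.
move=> z0 f0 fz; elim: s => [|i s IH].
  by rewrite big_nil /rdisj; apply/meet_idPl.
by rewrite big_cons; apply: rdisjD => //; exact: rz_sum_ge0.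
Qed.

Lemma rpos_meet x y : rpos (Order.meet x y) = Order.meet (rpos x) (rpos y).
Proof. exact: rz_joinIl. Qed.

(** Here [2 (x ∧ y) <= x + y], and doubling can only increase a positive part. Transitivity and
    additivity of [llt] rest on this. *)
Lemma rz_meet_rposD x y :
  Order.meet (rpos x) (rpos y) <= rpos (x + y).
Proof.
rewrite -rpos_meet; set m := Order.meet x y.
have mm : m + m <= x + y by rewrite rz_leD ?leIl ?leIr.
apply: le_trans (rpos_le mm).
rewrite -[m + m]mulr2n -scaler_nat rz_scalepos// -[leLHS]scale1r.
by rewrite rz_leZr ?rpos_ge0// ler1n.
Qed.

Lemma rposD x y : rpos (x + y) <= rpos x + rpos y.
Proof. by rewrite leUx rz_leD ?le_rpos// rz_addr_ge0 ?rpos_ge0. Qed.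

End RieszBasics.

Section RieszHom.
Variables (R : realType) (E F : rieszType R) (f : E -> F).

Lemma riesz_hom_linear :
  riesz_hom f -> {L : {linear E -> F} | f = L :> (E -> F)}.
Proof.
move=> homf; have linf : linear f by case: homf.
pose L : {linear E -> F} :=
  HB.pack f (GRing.isLinear.Build R E F *:%R f linf).
by exists L.
Qed.

(** The elements [f x^+] and [f x^-] are disjoint with difference [f x], so [f] preserves positive
    parts. Joins are [y + (x - y)^+], and meets follow by negation. *)
Lemma riesz_hom_criterion : linear f ->
  (forall x y, rdisj x y -> rdisj (f x) (f y)) -> riesz_hom f.
Proof.
move=> linf disjf.
pose L : {linear E -> F} :=
  HB.pack f (GRing.isLinear.Build R E F *:%R f linf).
have fpos x : f (rpos x) = rpos (f x).
  have -> : f x = f (rpos x) - f (rpos (- x)).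
    by rewrite -[LHS]/(L x) -{1}(rposB x) linearB.
  by rewrite rdisj_rposB//; apply/disjf/rpos_disj.
have fjoin : Order.join_morphism f.
  move=> x y; have e (G : rieszType R) (u v : G) :
    Order.join u v = v + rpos (u - v).
    by rewrite /rpos rz_addjoin addr0 [v + _]addrC subrK.
  rewrite [in LHS]e [in RHS]e -[LHS]/(L _) linearD; congr (_ + _).
  by rewrite -[LHS]/(f _) fpos -[f (x - y)]/(L _) linearB.
split => // x y.
have e (G : rieszType R) (u v : G) : Order.meet u v = - Order.join (- u) (- v).
  by rewrite -rz_oppmeet opprK.
rewrite [in LHS]e [in RHS]e -[LHS]/(L _) linearN -[L _]/(f _) fjoin.
by rewrite -[f (- x)]/(L _) -[f (- y)]/(L _) !linearN.
Qed.

Hypothesis homf : riesz_hom f.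

Lemma riesz_homB x y : f (x - y) = f x - f y.
Proof. by have [L ->] := riesz_hom_linear homf; exact: linearB. Qed.

Lemma riesz_homZ a x : f (a *: x) = a *: f x.
Proof. by have [L ->] := riesz_hom_linear homf; exact: linearZ. Qed.

Lemma riesz_hom0 : f 0 = 0.
Proof. by have [L ->] := riesz_hom_linear homf; exact: linear0. Qed.

Lemma riesz_hom_le x y : x <= y -> f x <= f y.
Proof.
have [_ fmeet _] := homf.
by move=> /meet_idPl e; apply/meet_idPl; rewrite -fmeet e.
Qed.

Lemma riesz_hom_ge0 x : 0 <= x -> 0 <= f x.
Proof. by move=> /riesz_hom_le; rewrite riesz_hom0. Qed.

Lemma riesz_hom_rpos x : f (rpos x) = rpos (f x).
Proof. by have [_ _ fj] := homf; rewrite /rpos fj riesz_hom0. Qed.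

Lemma riesz_hom_disj x y : rdisj x y -> rdisj (f x) (f y).
Proof.
by have [_ fm _] := homf; rewrite /rdisj -fm => ->; exact: riesz_hom0.
Qed.

Lemma riesz_hom_inj : (forall x, 0 <= x -> f x = 0 -> x = 0) -> injective f.
Proof.
move=> ker x y fxy; apply/eqP; rewrite -subr_eq0; apply/eqP.
have h z : f z = 0 -> rpos z = 0.
  by move=> fz; apply: ker; rewrite ?rpos_ge0// riesz_hom_rpos fz rpos_id.
rewrite -(rposB (x - y)) !h ?subrr// ?opprB riesz_homB fxy subrr//.
Qed.

End RieszHom.

(** * Local Riesz homomorphisms into the reals *)

(** [mf_max] is maximality among proper filters of positive elements, in the form in which it is
    used: an element left outside is disjoint from some member. *)
Record maximal_filter (R : realType) (E : rieszType R) (U : set E) : Prop := {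
  mfI : forall u v, U u -> U v -> U (Order.meet u v);
  mf_gt0 : forall u, U u -> 0 < u;
  mf_up : forall u v, U u -> u <= v -> U v;
  mf_max : forall v, 0 <= v -> ~ U v -> exists2 u, U u & rdisj u v }.

(** Zorn's lemma for families closed under meets whose members all have a nonzero meet with every
    [w n]. Since [w] is decreasing, its terms can be adjoined to such a family, so a maximal one
    contains them. *)
Lemma maximal_filter_exists (R : realType) (E : rieszType R) (w : nat -> E) :
  (forall n, 0 < w n) -> (forall m n, (m <= n)%N -> w n <= w m) ->
  exists2 U, maximal_filter U & forall n, U (w n).
Proof.
move=> w0 wdec.
pose P (A : set E) := (forall u v, A u -> A v -> A (Order.meet u v)) /\
  (forall u n, A u -> 0 < Order.meet u (w n)).
have [A [PA Amax]] : exists A, P A /\ forall B, (A `<` B)%classic -> ~ P B.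
  apply: Zorn_bigcup => C CP Ctot; split.
    move=> u v [X CX Xu] [Y CY Yv].
    have [XY|YX] := Ctot _ _ CX CY.
      by exists Y => //; apply: (CP _ CY).1 => //; exact: XY.
    by exists X => //; apply: (CP _ CX).1 => //; exact: YX.
  by move=> u n [X CX Xu]; exact: (CP _ CX).2.
have [AI Aw] := PA.
(* Maximality: [v] is in [A] as soon as adjoining [v] and its meets with members of [A] preserves
   [P]. *)
have Aadd v : (forall n, 0 < Order.meet v (w n)) ->
    (forall u n, A u -> 0 < Order.meet (Order.meet u v) (w n)) -> A v.
  move=> vw uvw; apply: contrapT => nAv.
  pose B : set E := fun z => [\/ A z, z = v |
    exists2 u, A u & z = Order.meet u v].
  apply: (Amax B).
    split; first by move=> z Az; exact: Or31.
    by move=> /(_ v)BA; apply/nAv/BA/Or32.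
  split.
    move=> y z [Ay|->|[u Au ->]] [Az|->|[u' Au' ->]].
    - by apply: Or31; exact: AI.
    - by apply: Or33; exists y.
    - by apply: Or33; exists (Order.meet y u'); [exact: AI|rewrite meetA].
    - by apply: Or33; exists z => //; rewrite meetC.
    - by apply: Or32; rewrite meetxx.
    - by apply: Or33; exists u' => //; rewrite meetC -meetA meetxx.
    - by apply: Or33; exists (Order.meet u z); [exact: AI|rewrite meetAC].
    - by apply: Or33; exists u => //; rewrite -meetA meetxx.
    - apply: Or33; exists (Order.meet u u'); first exact: AI.
      by rewrite meetACA meetxx.
  move=> z n [Az|->|[u Au ->]] //; [exact: Aw|exact: uvw].
have Agt0 u : A u -> 0 < u.
  by move=> /(Aw u 0%N) /lt_le_trans -> //; exact: leIl.
have Aup u v : A u -> u <= v -> A v.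
  move=> Au uv; apply: Aadd => [n|u' n Au'].
    by apply: lt_le_trans (Aw u n Au) _; rewrite leI2.
  by apply: lt_le_trans (Aw _ n (AI _ _ Au' Au)) _; rewrite !leI2.
have AW m : A (w m).
  have meetw n : Order.meet (w m) (w n) = w (maxn m n).
    have [mn|nm] := leqP m n; first exact/meet_idPr/wdec.
    by apply/meet_idPl/wdec; exact: ltnW.
  apply: Aadd => [n|u n Au]; first by rewrite meetw.
  by rewrite -meetA meetw; exact: Aw.
exists A => //; split => // v v0 nAv.
apply: contrapT => h.
have {}h u : A u -> 0 < Order.meet u v.
  move=> Au; rewrite lt_neqAle lexI v0 (ltW (Agt0 _ Au)) !andbT eq_sym.
  by apply/eqP => d; apply: h; exists u.
apply/nAv/Aadd => [n|u n Au]; first by rewrite meetC; exact: h.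
by rewrite -meetA [Order.meet v _]meetC meetA; apply/h/AI.
Qed.

Section Localization.
Variables (R : realType) (E : rieszType R) (U : set E) (mfU : maximal_filter U).
Implicit Types x y z : E.

(* [llt x y] means that [x < y] holds near the maximal filter [U], seen as a
   point of the spectrum of [E]. *)
Definition llt x y : Prop := U (rpos (y - x)).

Lemma llt_irr x : ~ llt x x.
Proof. by move=> /(mf_gt0 mfU); rewrite subrr rpos_id// ltxx. Qed.

Lemma llt_trans x y z : llt x y -> llt y z -> llt x z.
Proof.
move=> xy yz; apply: (mf_up mfU (mfI mfU xy yz)).
apply: le_trans (rz_meet_rposD _ _) _; apply: rpos_le.
by rewrite addrC addrA subrK.
Qed.

Lemma llt_le_trans x y z : llt x y -> y <= z -> llt x z.
Proof. by move=> xy yz; apply: (mf_up mfU xy); rewrite rpos_le// rz_leD. Qed.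

Lemma le_llt_trans x y z : x <= y -> llt y z -> llt x z.
Proof.
by move=> xy yz; apply: (mf_up mfU yz); rewrite rpos_le// rz_leD// rz_leN.
Qed.

Lemma llt_asym x y : llt x y -> ~ llt y x.
Proof. by move=> xy yx; exact: llt_irr (llt_trans xy yx). Qed.

(** If both alternatives fail, members of [U] are disjoint from [(z - x)^+] and from [(y - z)^+].
    Their meet is then disjoint from [(y - x)^+], which is below the sum and belongs to [U]. *)
Lemma llt_total x y z : llt x y -> llt x z \/ llt z y.
Proof.
move=> xy; apply: contrapT => /not_orP[xz zy].
have [u Uu du] := mf_max mfU (rpos_ge0 _) xz.
have [v Uv dv] := mf_max mfU (rpos_ge0 _) zy.
have Uuv := mfI mfU Uu Uv; have uv0 := ltW (mf_gt0 mfU Uuv).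
have := mf_gt0 mfU (mfI mfU Uuv xy); rewrite lt_neqAle => /andP[/eqP ne0 _].
apply/ne0/esym/le_anti/andP; split; last by rewrite lexI uv0 rpos_ge0.
have -> : y - x = (z - x) + (y - z) by rewrite [RHS]addrC addrA subrK.
rewrite meetC; apply: le_trans (leI2 (rposD _ _) (lexx _)) _.
apply: le_trans (rz_meetDl (rpos_ge0 _) (rpos_ge0 _) uv0) _.
have d1 : rdisj (rpos (z - x)) (Order.meet u v).
  by apply: rdisj_le (rdisjC du) => //; [exact: rpos_ge0|exact: leIl].
have d2 : rdisj (rpos (y - z)) (Order.meet u v).
  by apply: rdisj_le (rdisjC dv) => //; [exact: rpos_ge0|exact: leIr].
by rewrite d1 d2 addr0.
Qed.

Lemma llt_add x y x' y' : llt x y -> llt x' y' -> llt (x + x') (y + y').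
Proof.
move=> xy xy'; apply: (mf_up mfU (mfI mfU xy xy')).
by apply: le_trans (rz_meet_rposD _ _) _; rewrite opprD addrACA.
Qed.

Lemma llt_opp x y : llt x y -> llt (- y) (- x).
Proof. by rewrite /llt opprK addrC. Qed.

(** Otherwise some member of [U] is disjoint from [a u], hence from [u], which is also a member. *)
Lemma mfZ (a : R) u : 0 < a -> U u -> U (a *: u).
Proof.
move=> a0 Uu; apply: contrapT => h; have u0 := ltW (mf_gt0 mfU Uu).
have [v Uv dv] := mf_max mfU (rz_scale_ge0 (ltW a0) u0) h.
have ai : 0 <= a^-1 by rewrite invr_ge0 ltW.
have := rdisj_scaler ai (ltW (mf_gt0 mfU Uv)) (rz_scale_ge0 (ltW a0) u0) dv.
rewrite scalerA mulVf ?gt_eqF// scale1r => d.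
by have := mf_gt0 mfU (mfI mfU Uv Uu); rewrite d ltxx.
Qed.

Lemma llt_scale (a : R) x y : 0 < a -> llt x y -> llt (a *: x) (a *: y).
Proof.
by move=> a0 /(mfZ a0); rewrite /llt -rz_scalepos ?ltW// scalerBr.
Qed.

Lemma llt_meet x y z : llt z x -> llt z y -> llt z (Order.meet x y).
Proof.
move=> zx zy; apply: (mf_up mfU (mfI mfU zx zy)).
by rewrite -rpos_meet ![_ - z]addrC rz_addmeet.
Qed.

Lemma llt_join x y z : llt x z -> llt y z -> llt (Order.join x y) z.
Proof.
move=> /llt_opp xz /llt_opp yz; rewrite -[Order.join x y]opprK -[z]opprK.
apply: llt_opp; rewrite -[x]opprK -[y]opprK -rz_oppmeet opprK.
exact: llt_meet.
Qed.

Variables (e : E) (Ue : U e).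

Lemma llt_scalel (r s : R) : r < s -> llt (r *: e) (s *: e).
Proof.
rewrite -subr_gt0 => rs; rewrite /llt -scalerBl.
by rewrite rz_scalepos ?ltW// rpos_id ?(ltW (mf_gt0 mfU Ue))//; exact: mfZ.
Qed.

(** The value of [x] relative to [e] at the point [U], described by its Dedekind cut. It is a
    relation because [x] may be infinite compared with [e]. *)
Definition lval x (p : R) : Prop :=
  (forall r, r < p -> llt (r *: e) x) /\ (forall r, p < r -> llt x (r *: e)).

Lemma lval_uniq x p q : lval x p -> lval x q -> p = q.
Proof.
move=> [xp px] [xq qx]; apply/eqP; rewrite eq_le !leNgt.
apply/andP; split; apply/negP => pq.
  exact: llt_asym (xp _ (midf_lt pq).2) (qx _ (midf_lt pq).1).
exact: llt_asym (xq _ (midf_lt pq).2) (px _ (midf_lt pq).1).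
Qed.

(** The value is the supremum of the [r] with [r e < x] near [U]. For [r] above it, [llt_total] is
    applied between [r e] and a smaller multiple of [e] that is still above the supremum. *)
Lemma lval_exists x (M : R) : llt x (M *: e) -> llt (- x) (M *: e) ->
  exists p, lval x p.
Proof.
move=> xM /llt_opp; rewrite opprK -scaleNr => Mx.
pose S : set R := fun r => llt (r *: e) x.
have Sub r s : S r -> llt x (s *: e) -> r <= s.
  move=> Sr xs; rewrite leNgt; apply/negP => sr.
  exact: llt_irr (llt_trans Sr (llt_trans xs (llt_scalel sr))).
have supS : has_sup S.
  by split; [exists (- M)|exists M => r Sr; exact: Sub xM].
exists (sup S); split=> r.
  rewrite -subr_gt0 => /sup_adherent/(_ supS)[s Ss]; rewrite opprB addrC subrK.
  by move=> /llt_scalel rs; exact: llt_trans rs Ss.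
move=> /midf_lt[Ss sr]; have [|//] := llt_total x (llt_scalel sr).
by move=> /(sup_upper_bound supS); rewrite leNgt Ss.
Qed.

Lemma lvalD x y p q : lval x p -> lval y q -> lval (x + y) (p + q).
Proof.
move=> [xp px] [yq qy]; split=> r rpq.
  (* The gap [p + q - r] is shared equally between the two summands. *)
  have h : r = (p - (p + q - r) / 2) + (q - (p + q - r) / 2) by lra.
  by rewrite h scalerDl; apply: llt_add; [apply: xp|apply: yq]; lra.
have h : r = (p - (p + q - r) / 2) + (q - (p + q - r) / 2) by lra.
by rewrite h scalerDl; apply: llt_add; [apply: px|apply: qy]; lra.
Qed.

Lemma lvalN x p : lval x p -> lval (- x) (- p).
Proof.
move=> [xp px]; split=> r rp; rewrite -[r]opprK scaleNr; apply: llt_opp.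
  by apply: px; lra.
by apply: xp; lra.
Qed.

Lemma lval0 : lval 0 0.
Proof. by split=> r /llt_scalel; rewrite scale0r. Qed.

Lemma lvalZ (a : R) x p : lval x p -> lval (a *: x) (a * p).
Proof.
move=> xp; have pos b : 0 < b -> lval (b *: x) (b * p).
  move=> b0; have [h1 h2] := xp.
  have er r : r *: e = b *: ((b^-1 * r) *: e).
    by rewrite scalerA mulrA mulfV ?gt_eqF// mul1r.
  split=> r rp; rewrite er; apply: llt_scale => //.
    by apply: h1; rewrite mulrC ltr_pdivrMr// mulrC.
  by apply: h2; rewrite mulrC ltr_pdivlMr// mulrC.
have [a0|a0|<-] := ltgtP 0 a; first exact: pos.
  rewrite -[a]opprK scaleNr mulNr; apply/lvalN/pos; lra.
by rewrite scale0r mul0r; exact: lval0.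
Qed.

Lemma lval_join x y p q : lval x p -> lval y q ->
  lval (Order.join x y) (Num.max p q).
Proof.
move=> [xp px] [yq qy]; split=> r.
  rewrite lt_max => /orP[/xp/llt_le_trans|/yq/llt_le_trans]; apply.
    exact: leUl.
  exact: leUr.
by rewrite gt_max => /andP[/px xr /qy yr]; exact: llt_join.
Qed.

Lemma lval_meet x y p q : lval x p -> lval y q ->
  lval (Order.meet x y) (Num.min p q).
Proof.
move=> [xp px] [yq qy]; split=> r.
  by rewrite lt_min => /andP[/xp xr /yq yr]; exact: llt_meet.
rewrite gt_min => /orP[/px/(le_llt_trans _)|/qy/(le_llt_trans _)]; apply.
  exact: leIl.
exact: leIr.
Qed.

Lemma lval_ge0 x p : 0 <= x -> lval x p -> 0 <= p.
Proof.
move=> x0 [_ px]; rewrite leNgt; apply/negP => /px.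
rewrite scale0r => /(le_llt_trans x0); exact: llt_irr.
Qed.

Lemma lval_unit : lval e 1.
Proof. by split=> r /llt_scalel; rewrite scale1r. Qed.

End Localization.

(* [local_hom phi (a, x, y)]: [phi] behaves like a Riesz homomorphism as far as
   [a], [x] and [y] are concerned. Real Riesz homomorphisms need not exist on the
   whole of [E]; those satisfying countably many such conditions do. *)
Definition local_hom (R : realType) (E : rieszType R) (phi : E -> R)
    (c : R * E * E) : Prop :=
  let: (a, x, y) := c in
  [/\ phi (a *: x + y) = a * phi x + phi y,
      phi (Order.meet x y) = Num.min (phi x) (phi y),
      phi (Order.join x y) = Num.max (phi x) (phi y)
    & 0 <= x -> 0 <= phi x].

Section LocalHomExists.
Variables (R : realType) (E : archRieszType R).

Lemma rz_arch_scale (x y : E) : 0 <= x -> (forall n, n%:R *: x <= y) -> x = 0.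
Proof.
by move=> x0 h; apply: (@rz_arch _ _ _ y) => // n; rewrite -scaler_nat.
Qed.

(* A point of the spectrum at which [e > 0] and all the [X n] are finite: a
   generic filter meeting the dense sets [\bigcup_M {w : w <= (M e - X n)^+}]. *)
Lemma finite_point (e : E) (X : nat -> E) : 0 < e -> (forall n, 0 <= X n) ->
  exists U, [/\ maximal_filter U, U e &
    forall n, exists M : R, llt U (X n) (M *: e)].
Proof.
move=> e0 X0.
(* If [w] were disjoint from every [(M e - x)^+], then [n w] would be disjoint from [(n w - x)^+],
   which lies below [n w] and so vanishes. Thus [n w <= x] for all [n], and [w = 0] by the
   Archimedean property. *)
have step (w : E) (x : E) : 0 < w <= e ->
    0 <= x ->
    exists M : R, 0 < Order.meet w (rpos (M *: e - x)).
  move=> /andP[w0 we] x0; apply: contrapT => h.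
  have {}h M : rdisj w (rpos (M *: e - x)).
    apply: contrapT => d; apply: h; exists M.
    by rewrite lt_neqAle eq_sym lexI rpos_ge0 ltW// !andbT; apply/eqP.
  suff wE : w = 0 by rewrite wE ltxx in w0.
  apply: (@rz_arch_scale _ x) => [|n]; first exact: ltW.
  have d : rdisj (n%:R *: w) (rpos (n%:R *: w - x)).
    apply/rdisjC/rdisj_scaler; rewrite ?ler0n ?rpos_ge0 ?ltW//.
    apply/rdisjC/(rdisj_le _ _ _ _ (h n%:R)) => //;
      rewrite ?rpos_ge0//; first exact: ltW.
    by rewrite rpos_le// rz_leD// rz_leZ.
  have pw : rpos (n%:R *: w - x) <= n%:R *: w.
    by rewrite leUx rz_leBlr [leRHS]addrC rz_ler_wDl// rz_scale_ge0// ltW.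
  rewrite -[x]add0r -rz_leBlr; apply: le_trans (le_rpos _) _.
  by rewrite -d lexI pw lexx.
(* The step for arbitrary [w] and [x], with [w] itself as default, so that choice yields a function
   to iterate. *)
have stepf (w : E) (x : E) : exists w' : E, [/\ 0 < w <= e -> 0 < w', w' <= w &
    0 < w <= e -> 0 <= x -> exists M : R, w' <= rpos (M *: e - x)].
  have [[we x0]|h] := pselect (0 < w <= e /\ 0 <= x).
    have [M M0] := step _ _ we x0; exists (Order.meet w (rpos (M *: e - x))).
    by split=> //; [exact: leIl|move=> _ _; exists M; exact: leIr].
  by exists w; split=> [/andP[]||we x0]//; case: h.
pose next w x := sval (cid (stepf w x)).
pose w := fix w n := if n is n'.+1 then next (w n') (X n') else e.
have wS n : w n.+1 = next (w n) (X n) by [].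
have we n : 0 < w n <= e.
  elim: n => [|n IH]; first by rewrite e0 /=.
  rewrite wS /next; case: cid => w' /= [h1 h2 _].
  by rewrite h1//= (le_trans h2)//; case/andP: IH.
have wdec m n : (m <= n)%N -> w n <= w m.
  elim: n => [|n IH]; first by rewrite leqn0 => /eqP->.
  rewrite leq_eqVlt => /predU1P[->//|/IH]; apply: le_trans.
  by rewrite wS /next; case: cid => w' [].
have w0 n : 0 < w n by case/andP: (we n).
have [U mfU Uw] := maximal_filter_exists w0 wdec.
exists U; split=> //; first exact: (Uw 0%N).
move=> n; have := Uw n.+1; rewrite wS /next; case: cid => w' /= [_ _ h] Uw'.
have [M wM] := h (we n) (X0 n); exists M; exact: mf_up Uw' wM.
Qed.

(** [phi] takes values relative to [e] at a point where all entries of the [c n] are finite; hence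
    [phi e = 1]. *)
Lemma local_hom_exists (e : E) (c : nat -> R * E * E) : 0 < e ->
  exists2 phi : E -> R, forall n, local_hom phi (c n) & 0 < phi e.
Proof.
move=> e0; pose X n := rabs (c n).1.2 + rabs (c n).2.
have [|U [mfU Ue Ufin]] := @finite_point e X e0.
  by move=> n; rewrite rz_addr_ge0 ?rabs_ge0.
have fin (z : E) n : rabs z <= X n -> exists p, lval U e z p.
  move=> zX; have [M XM] := Ufin n.
  have [z1 z2] : z <= rabs z /\ - z <= rabs z by rewrite leUl leUr.
  by apply: (lval_exists mfU Ue (M := M)); apply: le_llt_trans XM => //;
    exact: le_trans zX.
(* Elements without a value are sent to 0; the conditions [c n] only involve elements that have
   one. *)
pose phi z := xget 0 (lval U e z).
have phiE z p : lval U e z p -> phi z = p.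
  by move=> zp; apply: (lval_uniq mfU (xgetPex 0 _) zp); exists p.
exists phi => [n|]; last by rewrite (phiE _ _ (lval_unit mfU Ue)).
have [p xp] : exists p, lval U e (c n).1.2 p.
  by apply: (fin _ n); rewrite [leRHS]addrC rz_ler_wDl ?rabs_ge0.
have [q yq] : exists q, lval U e (c n).2 q.
  by apply: (fin _ n); rewrite rz_ler_wDl ?rabs_ge0.
rewrite /local_hom; case: (c n) xp yq => -[a x] y /= xp yq.
rewrite (phiE _ _ xp) (phiE _ _ yq); split.
- by apply/phiE/lvalD => //; apply: lvalZ.
- by apply/phiE/lval_meet.
- by apply/phiE/lval_join.
- by move=> x0; apply: lval_ge0 xp.
Qed.

End LocalHomExists.

(** * Reduced powers of the real line *)

Record sigma_filter (T : Type) := SigmaFilter {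
  large :> (T -> Prop) -> Prop;
  large_all : forall A, (forall t, A t) -> large A;
  large_sub : forall A B : T -> Prop, (forall t, A t -> B t) ->
    large A -> large B;
  large_cap : forall A : nat -> T -> Prop, (forall n, large (A n)) ->
    large (fun t => forall n, A n t) }.

Section ReducedPower.
Local Open Scope quotient_scope.
Variables (R : realType) (T : Type) (L : sigma_filter T).
Implicit Types f g h : T -> R.

Lemma large_and (A B : T -> Prop) : L A -> L B -> L (fun t => A t /\ B t).
Proof.
move=> LA LB; pose C n := if n is 0%N then A else B.
apply: large_sub (large_cap (A := C) _) => [t h|[|n]//].
by split; [exact: (h 0%N)|exact: (h 1%N)].
Qed.

Lemma large_and_sub (A B C : T -> Prop) : L A -> L B ->
  (forall t, A t -> B t -> C t) -> L C.
Proof.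
by move=> LA LB ABC; apply: large_sub (large_and LA LB) => t [/ABC]; apply.
Qed.

Definition rpow_equiv : rel (T -> R) :=
  fun f g => `[< L (fun t => f t = g t) >].

Fact rpow_equiv_refl : reflexive rpow_equiv.
Proof. by move=> f; apply/asboolP/large_all. Qed.

Fact rpow_equiv_sym : symmetric rpow_equiv.
Proof. by move=> f g; apply/asboolP/asboolP; apply: large_sub. Qed.

Fact rpow_equiv_trans : transitive rpow_equiv.
Proof.
move=> g f h /asboolP fg /asboolP gh; apply/asboolP.
by apply: (large_and_sub fg gh) => t -> ->.
Qed.

Canonical rpow_equiv_equiv :=
  EquivRel rpow_equiv rpow_equiv_refl rpow_equiv_sym rpow_equiv_trans.

Definition rpow := {eq_quot rpow_equiv}.
HB.instance Definition _ := Choice.on rpow.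
HB.instance Definition _ := Quotient.on rpow.

Implicit Types x y z : rpow.

Definition germ f : rpow := \pi f.

Lemma germP f g : germ f = germ g <-> L (fun t => f t = g t).
Proof. by split=> [/eqmodP/asboolP|h]//; apply/eqmodP/asboolP. Qed.

Lemma reprE f : L (fun t => repr (germ f) t = f t).
Proof. by apply/germP; rewrite /germ reprK. Qed.

Lemma germW (P : rpow -> Prop) : (forall f, P (germ f)) -> forall x, P x.
Proof. by move=> Pf x; rewrite -[x]reprK; exact: Pf. Qed.

Definition germ1 (op : R -> R) x : rpow := germ (fun t => op (repr x t)).
Definition germ2 (op : R -> R -> R) x y : rpow :=
  germ (fun t => op (repr x t) (repr y t)).

Lemma germ1E op f : germ1 op (germ f) = germ (fun t => op (f t)).
Proof. by apply/germP/(large_sub _ (reprE f)) => t ->. Qed.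

Lemma germ2E op f g :
  germ2 op (germ f) (germ g) = germ (fun t => op (f t) (g t)).
Proof. by apply/germP/(large_and_sub (reprE f) (reprE g)) => t -> ->. Qed.

Definition rpow_le : rel rpow :=
  fun x y => `[< L (fun t => repr x t <= repr y t) >].

Fact rpow_addA : associative (germ2 +%R).
Proof.
elim/germW => f; elim/germW => g; elim/germW => h; rewrite !germ2E.
by congr germ; apply/funext => t; rewrite addrA.
Qed.
Fact rpow_addC : commutative (germ2 +%R).
Proof.
elim/germW => f; elim/germW => g; rewrite !germ2E.
by congr germ; apply/funext => t; rewrite addrC.
Qed.
Fact rpow_add0 : left_id (germ (fun=> 0)) (germ2 +%R).
Proof.
by elim/germW => f; rewrite germ2E; congr germ; apply/funext => t; rewrite add0r.
Qed.
Fact rpow_addN : left_inverse (germ (fun=> 0)) (germ1 -%R) (germ2 +%R).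
Proof.
elim/germW => f; rewrite germ1E germ2E.
by congr germ; apply/funext => t; rewrite addNr.
Qed.

HB.instance Definition _ :=
  GRing.isZmodule.Build rpow rpow_addA rpow_addC rpow_add0 rpow_addN.

Lemma germD f g : germ f + germ g = germ (fun t => f t + g t).
Proof. exact: germ2E. Qed.

Definition rpow_scale (a : R) x : rpow := germ1 ( *%R a) x.

Fact rpow_scaleA (a b : R) x :
  rpow_scale a (rpow_scale b x) = rpow_scale (a * b) x.
Proof.
elim/germW: x => f; rewrite /rpow_scale !germ1E.
by congr germ; apply/funext => t; rewrite mulrA.
Qed.
Fact rpow_scale1 : left_id 1 rpow_scale.
Proof.
elim/germW => f; rewrite /rpow_scale germ1E.
by congr germ; apply/funext => t; rewrite mul1r.
Qed.
Fact rpow_scaleDr : right_distributive rpow_scale +%R.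
Proof.
move=> a; elim/germW => f; elim/germW => g; rewrite /rpow_scale germD !germ1E germD.
by congr germ; apply/funext => t; rewrite mulrDr.
Qed.
Fact rpow_scaleDl x : {morph rpow_scale^~ x : a b / a + b}.
Proof.
elim/germW: x => f a b; rewrite /rpow_scale !germ1E germD.
by congr germ; apply/funext => t; rewrite mulrDl.
Qed.

HB.instance Definition _ :=
  GRing.Zmodule_isLmodule.Build R rpow rpow_scaleA rpow_scale1
    rpow_scaleDr rpow_scaleDl.

Lemma germN f : - germ f = germ (fun t => - f t).
Proof. exact: germ1E. Qed.

Lemma germZ a f : a *: germ f = germ (fun t => a * f t).
Proof. exact: germ1E. Qed.

Lemma germ0 : 0 = germ (fun=> 0) :> rpow.
Proof. by []. Qed.

Lemma germ_leP f g :
  reflect (L (fun t => f t <= g t)) (rpow_le (germ f) (germ g)).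
Proof.
have fg := large_and (reprE f) (reprE g).
by apply: (iffP (asboolP _)) => h; apply: (large_and_sub fg h) => t [-> ->].
Qed.

Fact rpow_le_refl : reflexive rpow_le.
Proof. by elim/germW => f; apply/germ_leP/large_all. Qed.
Fact rpow_le_anti : antisymmetric rpow_le.
Proof.
elim/germW => f; elim/germW => g /andP[/germ_leP fg /germ_leP gf].
by apply/germP/(large_and_sub fg gf) => t fgt gft; apply/le_anti/andP.
Qed.
Fact rpow_le_trans : transitive rpow_le.
Proof.
elim/germW => g; elim/germW => f; elim/germW => h /germ_leP fg /germ_leP gh.
by apply/germ_leP/(large_and_sub fg gh) => t; exact: le_trans.
Qed.

HB.instance Definition _ :=
  Order.Le_isPOrder.Build ring_display rpow rpow_le_refl rpow_le_anti
    rpow_le_trans.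

Lemma germ_le f g : reflect (L (fun t => f t <= g t)) (germ f <= germ g).
Proof. exact: germ_leP. Qed.

Fact rpow_meetP x y z : (x <= germ2 Num.min y z) = (x <= y) && (x <= z).
Proof.
elim/germW: x => f; elim/germW: y => g; elim/germW: z => h; rewrite germ2E.
apply/germ_le/andP => [fgh|[/germ_le fg /germ_le fh]].
  by split; apply/germ_le/(large_sub _ fgh) => t; rewrite le_min => /andP[].
by apply/(large_and_sub fg fh) => t; rewrite le_min => -> ->.
Qed.
Fact rpow_joinP x y z : (germ2 Num.max x y <= z) = (x <= z) && (y <= z).
Proof.
elim/germW: x => f; elim/germW: y => g; elim/germW: z => h; rewrite germ2E.
apply/germ_le/andP => [fgh|[/germ_le fh /germ_le gh]].
  by split; apply/germ_le/(large_sub _ fgh) => t; rewrite ge_max => /andP[].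
by apply/(large_and_sub fh gh) => t; rewrite ge_max => -> ->.
Qed.
Fact rpow_D2l z x y : x <= y -> z + x <= z + y.
Proof.
elim/germW: x => f; elim/germW: y => g; elim/germW: z => h /germ_le fg.
by rewrite !germD; apply/germ_le/(large_sub _ fg) => t; rewrite lerD2l.
Qed.
Fact rpow_scale_ge0 (a : R) x : 0 <= a -> 0 <= x -> 0 <= a *: x.
Proof.
elim/germW: x => f a0; rewrite germ0 => /germ_le f0.
by rewrite germZ; apply/germ_le/(large_sub _ f0) => t; exact: mulr_ge0.
Qed.

HB.instance Definition _ :=
  Lmodule_isRiesz.Build R rpow rpow_meetP rpow_joinP rpow_D2l rpow_scale_ge0.

Lemma germMn f n : germ f *+ n = germ (fun t => f t *+ n).
Proof. elim: n => [//|n IH]; rewrite mulrS IH germD.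
by congr germ; apply/funext => t; rewrite mulrS. Qed.

Lemma germ_min f g :
  rz_meet (germ f) (germ g) = germ (fun t => Num.min (f t) (g t)).
Proof. exact: germ2E. Qed.

Lemma germ_max f g :
  rz_join (germ f) (germ g) = germ (fun t => Num.max (f t) (g t)).
Proof. exact: germ2E. Qed.

(* This is where the filter has to be closed under countable intersections. *)
Fact rpow_arch x y : 0 <= x -> (forall n, x *+ n <= y) -> x = 0.
Proof.
elim/germW: x => f; elim/germW: y => g; rewrite germ0 => /germ_le f0 h.
have {}h n : L (fun t => f t *+ n <= g t) by apply/germ_le; rewrite -germMn.
apply/germP/(large_and_sub f0 (large_cap h)) => t f0t ht.
exact: (@regular_arch R (f t) (g t) f0t ht).
Qed.

HB.instance Definition _ := Riesz_isArchimedean.Build R rpow rpow_arch.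

End ReducedPower.

(** * Evaluating tensor terms at pairs of local homomorphisms *)

Section LocalTensor.
Variables (R : realType) (E F : archRieszType R).

(** Countably many local conditions on each side force membership in [A]. By [local_hom_exists],
    such an [A] contains pairs that are positive at any prescribed [e > 0] and [f > 0]. *)
Definition generic_pairs (A : (E -> R) * (F -> R) -> Prop) : Prop :=
  exists (c : nat -> R * E * E) (d : nat -> R * F * F), forall phi psi,
    (forall n, local_hom phi (c n)) -> (forall n, local_hom psi (d n)) ->
    A (phi, psi).

Fact generic_all A : (forall t, A t) -> generic_pairs A.
Proof. by move=> h; exists (fun=> (0, 0, 0)), (fun=> (0, 0, 0)). Qed.

Fact generic_sub (A B : (E -> R) * (F -> R) -> Prop) :
  (forall t, A t -> B t) -> generic_pairs A -> generic_pairs B.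
Proof.
by move=> AB [c [d h]]; exists c, d => phi psi hc hd; apply/AB/h.
Qed.

Fact generic_cap (A : nat -> (E -> R) * (F -> R) -> Prop) :
  (forall n, generic_pairs (A n)) -> generic_pairs (fun t => forall n, A n t).
Proof.
move=> /choice[c /choice[d h]].
(* A double sequence listed as a single one; numbers that code no pair merely repeat the entry at
   (0, 0). *)
pose seq2 (T : Type) (s : nat -> nat -> T) k :=
  if unpickle k is Some (i, j) then s i j else s 0%N 0%N.
have seq2E T (s : nat -> nat -> T) i j : seq2 T s (pickle (i, j)) = s i j.
  by rewrite /seq2 pickleK.
exists (seq2 _ c), (seq2 _ d) => phi psi hc hd n; apply: h => k.
  by rewrite -[c n k]seq2E.
by rewrite -[d n k]seq2E.
Qed.

Definition generic_filter : sigma_filter ((E -> R) * (F -> R)) :=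
  SigmaFilter generic_all generic_sub generic_cap.

Lemma generic_local_hom (c : R * E * E) (d : R * F * F) :
  generic_filter (fun t => local_hom t.1 c /\ local_hom t.2 d).
Proof.
exists (fun=> c), (fun=> d) => phi psi hc hd.
by split; [exact: hc 0%N|exact: hd 0%N].
Qed.

Definition local_tens (x : E) (y : F) : rpow R generic_filter :=
  germ _ (fun t => t.1 x * t.2 y).

(** Each identity involves finitely many elements, so one local condition on [phi] and one on [psi]
    enforce it on a large set of pairs. *)
Fact local_tens_bimorphism : riesz_bimorphism local_tens.
Proof.
have linl y : linear (local_tens^~ y).
  move=> a x x'; rewrite /local_tens germZ germD; apply/germP.
  apply: large_sub (generic_local_hom (a, x, x') (0, 0, 0)) => t [[-> _ _ _] _].
  by rewrite mulrDl mulrA.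
have linr x : linear (local_tens x).
  move=> a y y'; rewrite /local_tens germZ germD; apply/germP.
  apply: large_sub (generic_local_hom (0, 0, 0) (a, y, y')) => t [_ [-> _ _ _]].
  by rewrite mulrDr mulrCA.
split=> // [y y0|x x0]; split=> //.
- move=> x x'; apply: etrans (esym (germ_min _ _ _)); apply/germP.
  apply: large_sub (generic_local_hom (0, x, x') (0, y, 0)).
  by move=> t [[_ -> _ _] [_ _ _ /(_ y0)ty0]]; rewrite minr_pMl.
- move=> x x'; apply: etrans (esym (germ_max _ _ _)); apply/germP.
  apply: large_sub (generic_local_hom (0, x, x') (0, y, 0)).
  by move=> t [[_ _ -> _] [_ _ _ /(_ y0)ty0]]; rewrite maxr_pMl.
- move=> y y'; apply: etrans (esym (germ_min _ _ _)); apply/germP.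
  apply: large_sub (generic_local_hom (0, x, 0) (0, y, y')).
  by move=> t [[_ _ _ /(_ x0)tx0] [_ -> _ _]]; rewrite minr_pMr.
- move=> y y'; apply: etrans (esym (germ_max _ _ _)); apply/germP.
  apply: large_sub (generic_local_hom (0, x, 0) (0, y, y')).
  by move=> t [[_ _ _ /(_ x0)tx0] [_ _ -> _]]; rewrite maxr_pMr.
Qed.

Fixpoint reval (phi : E -> R) (psi : F -> R) (t : rterm E F R) : R :=
  match t with
  | TZero => 0
  | TTens x y => phi x * psi y
  | TOpp t => - reval phi psi t
  | TScale a t => a * reval phi psi t
  | TAdd t s => reval phi psi t + reval phi psi s
  | TMeet t s => Num.min (reval phi psi t) (reval phi psi s)
  | TJoin t s => Num.max (reval phi psi t) (reval phi psi s)
  end.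

Let b := Bimorphism local_tens_bimorphism.

Lemma teval_germ t : teval b t = germ _ (fun p => reval p.1 p.2 t).
Proof.
elim: t => /= [|x y|t ->|a t ->|t -> s ->|t -> s ->|t -> s ->]//.
- exact: germN.
- exact: germZ.
- exact: germD.
- exact: germ_min.
- exact: germ_max.
Qed.

(** The order of [tensq] is tested on all bimorphisms, in particular on [local_tens], and
    inequalities between germs hold on large sets. *)
Lemma generic_le (t s : rterm E F R) : (tpi t : tensq E F) <= tpi s ->
  generic_pairs (fun p => reval p.1 p.2 t <= reval p.1 p.2 s).
Proof.
by move=> /tensq_leP/(_ b); rewrite !qevalE !teval_germ => /germ_le.
Qed.

End LocalTensor.

(** * Sign patterns of lattice terms *)

Section SignPatterns.
Variable R : realType.

Definition form_val d (b : 'rV[R]_d) (l : 'cV[R]_d) : R := (b *m l) 0 0.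

Definition signs d (b : 'rV[R]_d) (ls : seq 'cV[R]_d) : seq R :=
  [seq Num.sg (form_val b l) | l <- ls].

Lemma form_val_comb d (u v : R) (b b' : 'rV[R]_d) l :
  form_val (u *: b + v *: b') l = u * form_val b l + v * form_val b' l.
Proof. by rewrite /form_val mulmxDl -!scalemxAl !mxE. Qed.

Lemma sg_comb (u v x y : R) : 0 < u -> 0 < v -> Num.sg x = Num.sg y ->
  Num.sg (u * x + v * y) = Num.sg x.
Proof.
move=> u0 v0; have [x0|x0|x0] := ltgtP x 0.
- rewrite (ltr0_sg x0) => /esym/eqP; rewrite sgr_cp0 => y0.
  by apply/eqP; rewrite sgr_cp0 -oppr_gt0 opprD -!mulrN addr_gt0 ?mulr_gt0 ?oppr_gt0.
- rewrite (gtr0_sg x0) => /esym/eqP; rewrite sgr_cp0 => y0.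
  by apply/eqP; rewrite sgr_cp0 addr_gt0 ?mulr_gt0.
- rewrite x0 sgr0 => /esym/eqP; rewrite sgr_eq0 => /eqP->.
  by rewrite !mulr0 addr0 sgr0.
Qed.

Lemma signs_comb d (u v : R) (b b' : 'rV[R]_d) ls : 0 < u -> 0 < v ->
  signs b ls = signs b' ls -> signs (u *: b + v *: b') ls = signs b ls.
Proof.
move=> u0 v0; elim: ls => //= l ls IH [hl /IH->].
by rewrite form_val_comb sg_comb.
Qed.

Lemma signs_mul d e (D : 'rV[R]_e) (K : 'M[R]_(e, d)) ls :
  signs (D *m K) ls = signs D [seq K *m l | l <- ls].
Proof. by elim: ls => //= l ls ->; rewrite /form_val mulmxA. Qed.

(* Adding a form splits in three only the sign patterns that are realised on its
   kernel, since the set of points with a given pattern is convex. *)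
Lemma sign_patterns_bound d (ls : seq 'cV[R]_d) :
  exists2 ps : seq (seq R), (size ps <= (3 * size ls + 1) ^ d)%N &
    forall b, signs b ls \in ps.
Proof.
move lsm: (size ls) => m; elim: m d ls lsm => [|m IH] d [|l ls]//=.
  by exists [:: [::]]; [rewrite exp1n|move=> b; rewrite inE].
move=> [lsm].
have expS k : ((3 * m + 1) ^ k <= (3 * m.+1 + 1) ^ k)%N.
  by case: k => // k; rewrite leq_exp2r//; lia.
have [l0|l0] := eqVneq l 0.
  have [ps psz psP] := IH d ls lsm; exists [seq 0 :: p | p <- ps].
    by rewrite size_map; apply: leq_trans psz (expS d).
  by move=> b; rewrite /= {1}/form_val l0 mulmx0 mxE sgr0 map_f.
(* The rows of [K] form a basis of the hyperplane [l = 0], which reduces the patterns on it to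
   dimension [d - 1]. *)
pose K := row_base (kermx l).
have dE : d = (\rank (kermx l)).+1.
  have := mxrank_eq0 l; rewrite (negbTE l0) mxrank_ker.
  by have := rank_leq_row l; have := rank_leq_col l; lia.
have [ps0 sz0 ps0P] := IH _ [seq K *m l' | l' <- ls] (etrans (size_map _ _) lsm).
have [ps1 sz1 ps1P] := IH d ls lsm.
(* A chosen point with pattern [p], with default 0 when no point realises it. *)
pose pt p : 'rV[R]_d := xget 0 [set b | signs b ls = p]%classic.
have ptP b : signs (pt (signs b ls)) ls = signs b ls.
  have : (exists c, signs c ls = signs b ls) by exists b.
  by move=> /(xgetPex 0).
pose sigma p := Num.sg (form_val (pt p) l).
(* The patterns in [ps0], which cover the kernel, are extended by all three signs; those in [ps1] by
   the sign of [l] at their chosen point. *)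
exists ([seq s :: p | s <- [:: -1; 0; 1], p <- ps0] ++
        [seq sigma p :: p | p <- ps1]).
  rewrite size_cat size_allpairs size_map; move: sz1; rewrite dE !expnS.
  (* Both summands contain [(3 m + 1) ^ (d - 1)], and [3 + (3 m + 1) = 3 (m + 1) + 1]. *)
  move=> sz1; apply: leq_trans (_ : 3 * (3 * m + 1) ^ \rank (kermx l) +
    (3 * m + 1) * (3 * m + 1) ^ \rank (kermx l) <= _)%N.
    by rewrite leq_add//= leq_mul.
  by rewrite -mulnDl leq_mul//; lia.
have kerP b : form_val b l = 0 -> signs b ls \in ps0.
  move=> bl0; have /submxP[D bE] : (b <= K)%MS.
    rewrite eq_row_base; apply/sub_kermxP/matrixP => i j.
    by rewrite !ord1 [RHS]mxE.
  suff -> : signs b ls = signs D [seq K *m l' | l' <- ls] by [].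
  by rewrite bE signs_mul.
move=> b; rewrite mem_cat.
apply/orP.
have [h0|h0] := boolP (signs b ls \in ps0).
  left; apply: allpairs_f => //.
  by rewrite !inE; case: sgrP; rewrite eqxx ?orbT.
right; suff -> : Num.sg (form_val b l) = sigma (signs b ls) by rewrite map_f.
rewrite /sigma; move: (ptP b); set b0 := pt _ => b0P.
have nz : form_val b l != 0 by apply: contra h0 => /eqP/kerP.
have nz0 : form_val b0 l != 0 by apply: contra h0 => /eqP/kerP; rewrite b0P.
apply/eqP/negPn/negP => ne; move/negP: h0; apply.
(* When [l] has opposite signs at [b] and [b0], it vanishes at [u b + v b0]. This point has the
   pattern of [b], which would therefore be in [ps0]. *)
pose u := `|form_val b0 l|; pose v := `|form_val b l|.
rewrite -(@signs_comb _ u v b b0) ?normr_gt0//.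
apply: kerP; rewrite form_val_comb /u /v; apply/eqP; move: ne => {u v}.
case: (ltgtP (form_val b l) 0) nz => // s1 _;
  case: (ltgtP (form_val b0 l) 0) nz0 => // s2 _.
- by rewrite !ltr0_sg ?eqxx.
- by move=> _; rewrite (gtr0_norm s2) (ltr0_norm s1) mulrC mulNr addrN.
- by move=> _; rewrite (ltr0_norm s2) (gtr0_norm s1) mulrC mulrN addNr.
- by rewrite !gtr0_sg ?eqxx.
Qed.

End SignPatterns.

(** * Lattice terms as piecewise linear functions *)

Section PiecewiseLinear.
Variables (R : realType) (E F : archRieszType R) (ys : seq F).
Let k := size ys.
Implicit Types (phi : E -> R) (psi : F -> R) (t : rterm E F R).

Definition coords psi : 'rV[R]_k := \row_j psi (nth 0 ys j).

(** Using [index] puts the weight on a single coordinate even if [ys] has repetitions. *)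
Definition tens_form phi (x : E) (y : F) : 'cV[R]_k :=
  \col_j (phi x *+ (index y ys == j)).

(* For fixed [phi], [reval phi psi t] is a piecewise linear function of
   [coords psi]; its linear pieces are among [pieces phi t], and which one is
   active is determined by the signs of the forms in [walls phi t]. *)
Fixpoint pieces phi t : seq 'cV[R]_k :=
  match t with
  | TZero => [:: 0]
  | TTens x y => [:: tens_form phi x y]
  | TOpp t => [seq - u | u <- pieces phi t]
  | TScale a t => [seq a *: u | u <- pieces phi t]
  | TAdd t s => [seq u + v | u <- pieces phi t, v <- pieces phi s]
  | TMeet t s | TJoin t s => pieces phi t ++ pieces phi s
  end.

Fixpoint walls phi t : seq 'cV[R]_k :=
  match t with
  | TZero | TTens _ _ => [::]
  | TOpp t | TScale _ t => walls phi t
  | TAdd t s => walls phi t ++ walls phi s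
  | TMeet t s | TJoin t s => walls phi t ++ walls phi s ++
      [seq u - v | u <- pieces phi t, v <- pieces phi s]
  end.

(** The number of pieces depends on the shape of [t] alone; with [size_walls] this bounds the forms
    uniformly over the rows [phi n]. *)
Lemma size_pieces phi phi' t : size (pieces phi t) = size (pieces phi' t).
Proof.
elim: t => //= [t IH|a t IH|t IHt s IHs|t IHt s IHs|t IHt s IHs].
- by rewrite !size_map.
- by rewrite !size_map.
- by rewrite !size_allpairs IHt IHs.
- by rewrite !size_cat IHt IHs.
- by rewrite !size_cat IHt IHs.
Qed.

Lemma size_walls phi phi' t : size (walls phi t) = size (walls phi' t).
Proof.
elim: t => //= [t IHt s IHs|t IHt s IHs|t IHt s IHs].
- by rewrite !size_cat IHt IHs.
- by rewrite !size_cat !size_allpairs IHt IHs !(size_pieces phi phi').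
- by rewrite !size_cat !size_allpairs IHt IHs !(size_pieces phi phi').
Qed.

Fixpoint factors t : seq F :=
  match t with
  | TZero => [::]
  | TTens _ y => [:: y]
  | TOpp t | TScale _ t => factors t
  | TAdd t s | TMeet t s | TJoin t s => factors t ++ factors s
  end.

Lemma tens_formE phi psi x y : y \in ys ->
  form_val (coords psi) (tens_form phi x y) = phi x * psi y.
Proof.
move=> yys; have i0 : (index y ys < k)%N by rewrite index_mem.
rewrite /form_val mxE (bigD1 (Ordinal i0))//= big1 => [|j ji].
  by rewrite !mxE eqxx mulr1n addr0 nth_index// mulrC.
rewrite !mxE; case: eqP => [e|_]; last by rewrite mulr0n mulr0.
by case/eqP: ji; apply: val_inj; rewrite /= e.
Qed.

Lemma form_valD d (b : 'rV[R]_d) u v :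
  form_val b (u + v) = form_val b u + form_val b v.
Proof. by rewrite /form_val mulmxDr mxE. Qed.

Lemma form_valN d (b : 'rV[R]_d) u : form_val b (- u) = - form_val b u.
Proof. by rewrite /form_val mulmxN mxE. Qed.

Lemma form_valZ d (b : 'rV[R]_d) a u : form_val b (a *: u) = a * form_val b u.
Proof. by rewrite /form_val -scalemxAr mxE. Qed.

Lemma sg_sub_le (x y x' y' : R) : Num.sg (x - y) = Num.sg (x' - y') ->
  (x <= y) = (x' <= y').
Proof. by move=> e; rewrite -subr_le0 -sgr_le0 e sgr_le0 subr_le0. Qed.

Lemma signs_cat d (b : 'rV[R]_d) s1 s2 :
  signs b (s1 ++ s2) = signs b s1 ++ signs b s2.
Proof. exact: map_cat. Qed.

Lemma signs_catP d (b b' : 'rV[R]_d) s1 s2 :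
  signs b (s1 ++ s2) = signs b' (s1 ++ s2) ->
  signs b s1 = signs b' s1 /\ signs b s2 = signs b' s2.
Proof.
rewrite !signs_cat => /eqP; rewrite eqseq_cat ?size_map//.
by move=> /andP[/eqP-> /eqP->].
Qed.

Lemma signsP d (b b' : 'rV[R]_d) s u : signs b s = signs b' s -> u \in s ->
  Num.sg (form_val b u) = Num.sg (form_val b' u).
Proof.
elim: s => //= v s IH [hv /IH hs]; rewrite inE => /predU1P[->|] //.
Qed.

Lemma sub_cat t s : {subset factors t ++ factors s <= ys} ->
  {subset factors t <= ys} /\ {subset factors s <= ys}.
Proof. by move=> h; split=> y yt; apply: h; rewrite mem_cat yt ?orbT. Qed.

Lemma form_valB d (b : 'rV[R]_d) u v :
  form_val b (u - v) = form_val b u - form_val b v.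
Proof. by rewrite form_valD form_valN. Qed.

(** Equal signs on the walls make every comparison inside [t] come out the same way, so both
    evaluations follow the same linear piece. *)
Lemma piecesP phi psi psi' t : {subset factors t <= ys} ->
  signs (coords psi) (walls phi t) = signs (coords psi') (walls phi t) ->
  exists u, [/\ u \in pieces phi t, reval phi psi t = form_val (coords psi) u
    & reval phi psi' t = form_val (coords psi') u].
Proof.
elim: t => [|x y|t IH|a t IH|t IHt s IHs|t IHt s IHs|t IHt s IHs]/= sub.
- by move=> _; exists 0; rewrite inE /form_val !mulmx0 !mxE.
- move=> _; exists (tens_form phi x y); rewrite inE !tens_formE ?sub ?inE//.
- move=> /(IH sub)[u [ut -> ->]]; exists (- u).
  by rewrite !form_valN map_f.
- move=> /(IH sub)[u [ut -> ->]]; exists (a *: u).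
  by rewrite !form_valZ map_f.
- have [subt subs] := sub_cat sub.
  move=> /signs_catP[/(IHt subt)[u [ut -> ->]] /(IHs subs)[v [vs -> ->]]].
  by exists (u + v); rewrite !form_valD allpairs_f.
- have [subt subs] := sub_cat sub.
  move=> /signs_catP[/(IHt subt)[u [ut -> ->]] /signs_catP[]].
  move=> /(IHs subs)[v [vs -> ->]] /signsP/(_ (allpairs_f _ ut vs)).
  rewrite !form_valB => /sg_sub_le uv; rewrite !minEle -uv.
  exists (if form_val (coords psi) u <= form_val (coords psi) v then u else v).
  by case: ifP; rewrite mem_cat ?ut ?vs ?orbT.
- have [subt subs] := sub_cat sub.
  move=> /signs_catP[/(IHt subt)[u [ut -> ->]] /signs_catP[]].
  move=> /(IHs subs)[v [vs -> ->]] /signsP/(_ (allpairs_f _ ut vs)).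
  rewrite !form_valB => /sg_sub_le uv; rewrite !maxEle -uv.
  exists (if form_val (coords psi) u <= form_val (coords psi) v then v else u).
  by case: ifP; rewrite mem_cat ?ut ?vs ?orbT.
Qed.

(** The walls select the active piece; the pieces are included so that its sign is recorded too. *)
Definition forms phi t : seq 'cV[R]_k := walls phi t ++ pieces phi t.

Lemma sg_reval phi psi psi' t : {subset factors t <= ys} ->
  signs (coords psi) (forms phi t) = signs (coords psi') (forms phi t) ->
  Num.sg (reval phi psi t) = Num.sg (reval phi psi' t).
Proof.
move=> sub /signs_catP[hw hp]; have [u [ut -> ->]] := piecesP sub hw.
exact: signsP hp ut.
Qed.

End PiecewiseLinear.

Lemma exp_lt_exp2 (c k : nat) : exists N, ((c * N + 1) ^ k < 2 ^ N)%N.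
Proof.
have [i iE] : exists i, i = (k + c + 2)%N by exists (k + c + 2)%N.
(* With this [N] the base is at most [2 ^ (4 i + c + 1)], so the left side is at most 2 to the power
   [(4 i + c + 1) k]. This exponent is at most [5 i^2], which is less than
   [(i + 1)^4 <= 2 ^ (4 i) = N]. *)
exists (2 ^ (4 * i))%N.
have lt2 n : (n.+1 <= 2 ^ n)%N by exact: ltn_expl.
have h1 : (c * 2 ^ (4 * i) + 1 <= 2 ^ (4 * i + c + 1))%N.
  rewrite (expnD 2 (4 * i + c) 1) (expnD 2 (4 * i) c) expn1.
  have := lt2 c; have : (0 < 2 ^ (4 * i))%N by rewrite expn_gt0.
  move: (2 ^ (4 * i))%N (2 ^ c)%N => p q /= p0 cq.
  have : (c * p + p <= p * q)%N by rewrite -mulSnr mulnC leq_mul.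
  by move: (c * p)%N (p * q)%N => u v; lia.
apply: leq_ltn_trans (_ : (2 ^ (4 * i + c + 1)) ^ k < _)%N.
  by case: (k) => // k'; rewrite leq_exp2r.
rewrite -expnM ltn_exp2l//.
have kE : ((4 * i + c + 1) * k <= (5 * i) * i)%N by rewrite leq_mul//; lia.
apply: leq_ltn_trans kE _; rewrite mulnC expnM.
have i2 : (2 <= i)%N by lia.
apply: leq_trans (_ : i.+1 ^ 4 <= _)%N; last by rewrite expnAC leq_exp2r.
rewrite !expnS expn0 muln1; move: i i2 {iE h1} => j j2.
have : (9 <= j.+1 * j.+1)%N by nia.
by move: (j.+1 * j.+1)%N (erefl (j.+1 * j.+1)%N) => q qE; nia.
Qed.

(* The relation [n \in unpickle m] shatters every finite set of rows [n]. *)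
Lemma no_universal_term (R : realType) (E F : archRieszType R)
    (t : rterm E F R) (phi : nat -> E -> R) (psi : nat -> F -> R) :
  ~ forall n m, (0 < reval (phi n) (psi m) t) =
                (n \in odflt [::] (unpickle m : option (seq nat))).
Proof.
move=> h; pose ys := factors t; pose k := size ys.
pose r := size (forms ys (phi 0%N) t).
have [N ltN] := exp_lt_exp2 (3 * r) k.
pose ls := flatten [seq forms ys (phi n) t | n <- iota 0 N].
have szls : size ls = (r * N)%N.
  rewrite size_flatten /shape -map_comp.
  rewrite (eq_map (g := fun=> r)); last first.
    move=> n /=; rewrite /r !size_cat (size_walls _ (phi n) (phi 0%N)).
    by rewrite (size_pieces _ (phi n) (phi 0%N)).
  by rewrite sumnE big_map big_const_seq count_predT size_iota iter_addn_0.
have [ps szps psP] := sign_patterns_bound ls.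
(* In column [m S], exactly the rows in [S] are positive among the first [N]; hence distinct [S]
   give distinct sign patterns, [2 ^ N] in all. *)
pose m (S : {set 'I_N}) := pickle [seq val i | i <- enum S].
have inj : injective (fun S => signs (coords ys (psi (m S))) ls).
  move=> S S' eqs; apply/setP => i.
  have mem (A : {set 'I_N}) : (i \in A) = (0 < reval (phi i) (psi (m A)) t).
    by rewrite h /m pickleK /= mem_map ?mem_enum//; exact: val_inj.
  rewrite (mem S) (mem S') -[LHS]sgr_gt0 -[RHS]sgr_gt0; congr (0 < _);
  apply: (@sg_reval _ _ _ ys) => //.
  have : {subset forms ys (phi i) t <= ls}.
    move=> u ui; apply/flattenP; exists (forms ys (phi i) t) => //.
    by apply/mapP; exists (val i); rewrite // mem_iota ltn_ord.
  by move=> sub; apply/eq_in_map => u /sub; exact: signsP eqs.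
have : (#|{set 'I_N}| <= size ps)%N.
  rewrite cardE -(size_map (fun S => signs (coords ys (psi (m S))) ls)).
  apply: uniq_leq_size; first by rewrite map_inj_uniq// enum_uniq.
  by move=> _ /mapP[S _ ->].
rewrite -cardsT -powersetT card_powerset cardsT card_ord leqNgt => /negP; apply.
by apply: leq_ltn_trans ltN; rewrite -mulnA -szls.
Qed.

(** * Disjoint sequences and order suprema in the tensor product *)

Definition disjoint_seq (R : realType) (E : rieszType R) (x : E) (e : nat -> E) :=
  [/\ forall n, 0 < e n, forall n, e n <= x &
      forall m n, m != n -> rdisj (e m) (e n)].

(** [s - (s ∧ t)] is again an upper bound of [S]: any [a] in [S] is disjoint from [s ∧ t], so
    [a + (s ∧ t)] is their join and stays below [s]. *)
Lemma rdisj_sup (R : realType) (E : rieszType R) (S : set E) (s t : E) :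
  0 <= s -> 0 <= t -> supremums S s -> (forall a, S a -> rdisj a t) -> rdisj s t.
Proof.
move=> s0 t0 [ubs lubs] dS; apply: le_rdisj => //.
have /lubs : ubound S (s - Order.meet s t).
  move=> a Sa; rewrite rz_leBrr rz_meetjoin.
  have -> : Order.meet a (Order.meet s t) = 0.
    by rewrite meetCA (dS _ Sa); apply/meet_idPr.
  by rewrite add0r leUx leIl ubs.
by rewrite rz_leBrr -[leRHS]addr0 rz_leDl.
Qed.

Section Bimorphisms.
Variables (R : realType) (E F G : rieszType R) (T : E -> F -> G).
Hypothesis bimT : riesz_bimorphism T.

Lemma bimorphism_homl y : 0 <= y -> riesz_hom (T^~ y).
Proof. by case: bimT => _ _ h _; exact: h. Qed.

Lemma bimorphism_homr x : 0 <= x -> riesz_hom (T x).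
Proof. by case: bimT => _ _ _; exact. Qed.

Lemma bimorphism_ge0 x y : 0 <= x -> 0 <= y -> 0 <= T x y.
Proof. by move=> x0 y0; exact: (riesz_hom_ge0 (bimorphism_homr x0)). Qed.

Lemma bimorphism_le x x' y y' : 0 <= x -> 0 <= y' -> x <= x' -> y <= y' ->
  T x y <= T x' y'.
Proof.
move=> x0 y0 xx yy; apply: (@le_trans _ _ (T x y')).
  exact: (riesz_hom_le (bimorphism_homr x0)).
exact: (riesz_hom_le (bimorphism_homl y0)).
Qed.

(** The two tensors are dominated by those with second factor [y + y'], and [T^~ (y + y')] is a
    Riesz homomorphism. *)
Lemma bimorphism_disjl x x' y y' : 0 <= x -> 0 <= x' -> 0 <= y -> 0 <= y' ->
  rdisj x x' -> rdisj (T x y) (T x' y').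
Proof.
move=> x0 x'0 y0 y'0 d; have yy : 0 <= y + y' by exact: rz_addr_ge0.
apply: rdisj_le (riesz_hom_disj (bimorphism_homl yy) d);
  rewrite ?bimorphism_ge0// bimorphism_le//.
  by rewrite addrC rz_ler_wDl.
by rewrite rz_ler_wDl.
Qed.

Lemma bimorphism_disjr x x' y y' : 0 <= x -> 0 <= x' -> 0 <= y -> 0 <= y' ->
  rdisj y y' -> rdisj (T x y) (T x' y').
Proof.
move=> x0 x'0 y0 y'0 d; have xx : 0 <= x + x' by exact: rz_addr_ge0.
apply: rdisj_le (riesz_hom_disj (bimorphism_homr xx) d);
  rewrite ?bimorphism_ge0// bimorphism_le//.
  by rewrite addrC rz_ler_wDl.
by rewrite rz_ler_wDl.
Qed.

End Bimorphisms.

Lemma tensor_not_dedekind_complete (R : realType) (E F : archRieszType R)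
    (x : E) (e : nat -> E) (y : F) (f : nat -> F) :
  disjoint_seq x e -> disjoint_seq y f -> ~ dedekind_complete (E ⊗ F).
Proof.
move=> [e0 ex ed] [f0 fy fd] dc.
have e0' n := ltW (e0 n); have f0' n := ltW (f0 n).
pose T := ft_tens (fremlin E F); have bT := ft_bimorphism (fremlin E F).
have x0 : 0 <= x := le_trans (e0' 0%N) (ex 0%N).
have y0 : 0 <= y := le_trans (f0' 0%N) (fy 0%N).
(* Column [m] codes a finite list of rows; this is the relation excluded by [no_universal_term]. *)
pose A n m := n \in odflt [::] (unpickle m : option (seq nat)).
pose S : set (E ⊗ F) := fun z => exists n m, A n m /\ z = T (e n) (f m).
have A0 : S (T (e 0%N) (f (pickle [:: 0%N]))).
  by exists 0%N, (pickle [:: 0%N]); rewrite /A pickleK /= inE.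
have [s sups] : exists s, supremums S s.
  apply: dc; split; first by exists (T (e 0%N) (f (pickle [:: 0%N]))).
  by exists (T x y) => _ [n [m [_ ->]]]; exact: bimorphism_le.
have s0 : 0 <= s.
  by apply: le_trans (sups.1 _ A0); exact: bimorphism_ge0.
have inS n m : A n m -> T (e n) (f m) <= s.
  by move=> Anm; apply: sups.1; exists n, m.
(* Every generator in [S] differs from [T (e n) (f m)] in its row or its column, hence is disjoint
   from it, and disjointness passes to the supremum. *)
have outS n m : ~~ A n m -> rdisj s (T (e n) (f m)).
  move=> nA; apply: rdisj_sup sups _ => // [|_ [n' [m' [Anm' ->]]]].
    exact: bimorphism_ge0.
  have [nn|nn] := eqVneq n' n; last first.
    by apply: bimorphism_disjl => //; apply: ed.
  have [mm|mm] := eqVneq m' m; last first.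
    by apply: bimorphism_disjr => //; apply: fd.
  by move: nA; rewrite -nn -mm Anm'.
pose t : rterm E F R := repr (s : tensq E F).
have tE : s = tpi t by rewrite /t /tpi reprK.
(* The relations [inS] and [outS] read at a pair of real maps. There are countably many, so they
   hold together on a large set. *)
pose B n m (p : (E -> R) * (F -> R)) := if A n m
  then p.1 (e n) * p.2 (f m) <= reval p.1 p.2 t
  else Num.min (reval p.1 p.2 t) (p.1 (e n) * p.2 (f m)) <= 0.
have genB : generic_filter E F (fun p => forall n m, B n m p).
  apply: large_cap => n; apply: large_cap => m.
  pose u : rterm E F R := TTens (e n) (f m).
  rewrite /B; case: (boolP (A n m)) => [/inS|/outS]; rewrite tE.
    exact: (@generic_le _ _ _ u t).
  move=> d; pose z : rterm E F R := TZero.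
  apply: (@generic_le R E F (TMeet t u) z).
  by rewrite tpiI le_eqVlt; apply/orP; left; apply/eqP.
have [c [d cd]] := genB.
have /choice[phi phiP] n : exists phi : E -> R,
    (forall n, local_hom phi (c n)) /\ 0 < phi (e n).
  by have [phi h1 h2] := local_hom_exists c (e0 n); exists phi.
have /choice[psi psiP] n : exists psi : F -> R,
    (forall n, local_hom psi (d n)) /\ 0 < psi (f n).
  by have [psi h1 h2] := local_hom_exists d (f0 n); exists psi.
apply: (@no_universal_term _ _ _ t phi psi) => n m.
have := cd _ _ (phiP n).1 (psiP m).1 n m; rewrite /B /= -/(A n m).
have pos : 0 < phi n (e n) * psi m (f m).
  by rewrite mulr_gt0 ?(phiP n).2 ?(psiP m).2.
case: ifP => _; first exact: lt_le_trans.
by rewrite ge_min leNgt [_ * _ <= 0]leNgt pos orbF => /negbTE.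
Qed.

(** * Atoms *)

Definition no_disjoint_seq (R : realType) (E : rieszType R) : Prop :=
  forall (x : E) (e : nat -> E), ~ disjoint_seq x e.

(** Each step splits off [v] and continues inside a remainder [u] disjoint from [v]; all later
    pieces lie below [u]. *)
Lemma disjoint_seq_iter (R : realType) (E : rieszType R) (P : E -> Prop) (x : E) :
  (forall z, P z -> exists u v : E,
     [/\ P u, 0 < v, v <= z, u <= z & rdisj u v]) ->
  P x -> exists e, disjoint_seq x e.
Proof.
move=> step Px.
have /choice[uv uvP] (z : E) : exists uv : E * E, P z ->
    [/\ P uv.1, 0 < uv.2, uv.2 <= z, uv.1 <= z & rdisj uv.1 uv.2].
  have [/step[u [v h]]|nPz] := pselect (P z); first by exists (u, v).
  by exists (0, 0).
pose X n := iter n (fun z => (uv z).1) x.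
have XP n : P (X n) by elim: n => //= n /uvP[].
have Xdec m n : (m <= n)%N -> X n <= X m.
  elim: n => [|n IH]; first by rewrite leqn0 => /eqP->.
  rewrite leq_eqVlt => /predU1P[->//|/IH]; apply: le_trans.
  by have [] := uvP _ (XP n).
exists (fun n => (uv (X n)).2); split=> [n|n|].
- by have [] := uvP _ (XP n).
- by have [_ _ h _ _] := uvP _ (XP n); apply: le_trans h (Xdec _ _ (leq0n n)).
suff lt m n : (m < n)%N -> rdisj (uv (X n)).2 (uv (X m)).2.
  move=> m n; rewrite neq_ltn => /orP[/lt/rdisjC|/lt]//.
move=> mn; have [_ v0 _ _ d] := uvP _ (XP m).
have [_ v0' v'X _ _] := uvP _ (XP n).
by apply: rdisj_le d => //; [exact: ltW|exact: ltW|exact: le_trans (Xdec _ _ mn)].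
Qed.

Definition atom (R : realType) (E : rieszType R) (a : E) : Prop :=
  0 < a /\ forall y, 0 <= y -> y <= a -> exists c : R, y = c *: a.

Section Atoms.
Variables (R : realType) (E : archRieszType R).
Implicit Types a x y z : E.

Lemma arch_le0 z x : (forall n, n%:R *: z <= x) -> z <= 0.
Proof.
move=> h; have x0 : 0 <= x by have := h 0%N; rewrite scale0r.
suff <- : rpos z = 0 by exact: le_rpos.
apply: (@rz_arch_scale _ _ _ x) => [|n]; first exact: rpos_ge0.
by rewrite -rz_scalepos// leUx h x0.
Qed.

(** From [(p - 1/n) a <= x] one gets [n (p a - x) <= a] for all [n >= 1], and the Archimedean
    property applies. *)
Lemma le_of_scale_lt (p : R) a x :
  0 <= a -> (forall c, c < p -> c *: a <= x) -> p *: a <= x.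
Proof.
move=> a0 h; rewrite -[leRHS]add0r -rz_leBlr; apply: (@arch_le0 _ a) => -[|n].
  by rewrite scale0r.
have n0 : 0 < n.+1%:R :> R by rewrite ltr0n.
rewrite scalerBr rz_leBlr addrC -rz_leBlr scalerA -{2}[a]scale1r -scalerBl.
have -> : n.+1%:R * p - 1 = n.+1%:R * (p - n.+1%:R^-1).
  by rewrite mulrBr mulfV// gt_eqF.
by rewrite -scalerA rz_lescale// h// ltrBlDr ltrDl invr_gt0.
Qed.

Lemma ge_of_scale_gt (p : R) a x :
  0 <= a -> (forall c, p < c -> x <= c *: a) -> x <= p *: a.
Proof.
move=> a0 h; rewrite -rz_leN -scaleNr; apply: le_of_scale_lt => // c cp.
by rewrite -[c]opprK scaleNr rz_leN; apply: h; rewrite ltrNr.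
Qed.

(** If [x] does not split, then [y] is comparable with every [c x], since otherwise [(y - c x)^+]
    and [(c x - y)^+] would split [x]. Hence [y] is the multiple of [x] by the supremum of the [c]
    with [c x <= y]. *)
Lemma not_atom_split x : 0 < x -> ~ atom x ->
  exists u v : E, [/\ 0 < u, 0 < v, u <= x, v <= x & rdisj u v].
Proof.
move=> x0 nx; apply: contrapT => nsplit; apply: nx; split=> // y y0 yx.
have xge0 := ltW x0.
have tot c : y <= c *: x \/ c *: x <= y.
  have [c0|c0] := ltP c 0.
    right; apply: le_trans y0; rewrite -[c]opprK scaleNr -oppr0 rz_leN.
    by rewrite rz_scale_ge0// oppr_ge0 ltW.
  have [c1|c1] := ltP 1 c.
    by left; apply: le_trans yx _; rewrite -[leLHS]scale1r rz_leZr// ltW.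
  apply: contrapT => /not_orP[ny nc]; apply: nsplit.
  exists (rpos (y - c *: x)), (rpos (c *: x - y)).
  have pos z : ~ z <= 0 -> 0 < rpos z.
    move=> h; rewrite lt_neqAle rpos_ge0 andbT eq_sym; apply/eqP => e.
    by apply: h; rewrite -e le_rpos.
  split.
  - by apply: pos; rewrite rz_leBlr add0r.
  - by apply: pos; rewrite rz_leBlr add0r.
  - rewrite leUx xge0 andbT rz_leBlr; apply: le_trans yx _.
    by rewrite addrC rz_ler_wDl// rz_scale_ge0.
  - rewrite leUx xge0 andbT rz_leBlr; apply: (@le_trans _ _ x).
      by rewrite -[leRHS]scale1r rz_leZr.
    by rewrite addrC rz_ler_wDl.
  - by rewrite -[c *: x - y]opprB; exact: rpos_disj.
pose S : set R := fun c => c *: x <= y.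
have xscale c c' : c *: x <= c' *: x -> c <= c'.
  move=> h; rewrite leNgt; apply/negP => cc'.
  have : (c - c') *: x <= (c - c') *: 0.
    by rewrite scaler0 scalerBl rz_leBlr add0r.
  by rewrite rz_lescale ?subr_gt0// => /(lt_le_trans x0); rewrite ltxx.
have supS : has_sup S.
  split; first by exists 0; rewrite /S scale0r.
  exists 1 => c Sc; apply: xscale; rewrite scale1r; exact: le_trans yx.
exists (sup S); apply: le_anti; apply/andP; split.
  apply: ge_of_scale_gt => // c Sc; have [//|cy] := tot c.
  by move: Sc; rewrite ltNge (sup_upper_bound supS).
apply: le_of_scale_lt => // c; rewrite -subr_gt0.
move=> /sup_adherent/(_ supS)[c' Sc']; rewrite opprB addrC subrK => cc'.
by apply: le_trans Sc'; rewrite rz_leZr// ltW.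
Qed.

(** [c] is the largest scalar with [c a <= x]. The meet of [x - c a] and [a] is some [d a]; then
    [(c + d) a <= x], so [d <= 0]. *)
Lemma atom_peel a x : atom a -> 0 <= x ->
  exists c : R, [/\ 0 <= c, c *: a <= x & rdisj (x - c *: a) a].
Proof.
move=> [a0 atoma] x0; have age0 := ltW a0.
pose S : set R := fun c => c *: a <= x.
have S0 : S 0 by rewrite /S scale0r.
have supS : has_sup S.
  split; first by exists 0.
  (* If [S] were unbounded, every [n a] would lie below [x], forcing [a = 0]. *)
  apply: contrapT => nub; move: a0.
  rewrite lt_neqAle eq_sym => /andP[/eqP an0 _].
  apply: an0; apply: (@rz_arch_scale _ _ _ x) => // n.
  apply: contrapT => nx; apply: nub.
  exists n%:R => c Sc; rewrite leNgt; apply/negP => nc; apply: nx.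
  by apply: le_trans Sc; rewrite rz_leZr// ltW.
exists (sup S); have c0 := sup_upper_bound supS S0.
have cx : sup S *: a <= x.
  apply: le_of_scale_lt => // c; rewrite -subr_gt0.
  move=> /sup_adherent/(_ supS)[c' Sc']; rewrite opprB addrC subrK => cc'.
  by apply: le_trans Sc'; rewrite rz_leZr// ltW.
split=> //; apply: le_rdisj => //; first by rewrite -rz_leBr.
set w := Order.meet _ _; have w0 : 0 <= w by rewrite lexI -rz_leBr cx.
have [d wd] := atoma w w0 (leIr _ _).
have : S (sup S + d).
  by rewrite /S scalerDl addrC -rz_leBrr -wd leIl.
move=> /(sup_upper_bound supS); rewrite gerDl => d0.
by rewrite wd -(scale0r a) rz_leZr.
Qed.

(** Splitting repeatedly inside an element with no atom below it would give a disjoint sequence, so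
    every nonzero positive element dominates an atom. Peeling atoms off a counterexample to [P]
    leaves a counterexample, and going on forever gives a disjoint sequence again. *)
Lemma atoms_ind (P : E -> Prop) : no_disjoint_seq E -> P 0 ->
  (forall (c : R) a y, atom a -> P y -> P (c *: a + y)) ->
  forall x, 0 <= x -> P x.
Proof.
move=> nds P0 Pa x x0; apply: contrapT => nPx.
have ex_atom z : 0 < z -> exists2 a, atom a & a <= z.
  move=> z0; apply: contrapT => na.
  have [|//|e /nds//] := @disjoint_seq_iter _ E
    (fun z => 0 < z /\ ~ exists2 a, atom a & a <= z) z.
  move=> t [t0 nt]; have [|u [v [u0 v0 ut vt d]]] := not_atom_split t0.
    by move=> at_; apply: nt; exists t.
  exists u, v; split=> //; split=> // -[a aa au]; apply: nt; exists a => //.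
  exact: le_trans ut.
have [|//|e /nds//] := @disjoint_seq_iter _ E (fun z => 0 <= z /\ ~ P z) x.
move=> z [z0 nPz].
have zgt0 : 0 < z.
  by rewrite lt_neqAle z0 andbT; apply/eqP => ze; apply: nPz; rewrite -ze.
have [a aa az] := ex_atom z zgt0; have [c [c0 caz d]] := atom_peel aa z0.
exists (z - c *: a), a; split=> //.
- split; first by rewrite -rz_leBr.
  by move=> Pu; apply: nPz; rewrite -[z](subrKC (c *: a)); exact: Pa.
- by case: aa.
- by rewrite rz_leBlr addrC rz_ler_wDl// rz_scale_ge0// ltW//; case: aa.
Qed.

End Atoms.

(** * Finitely supported functions *)

Section C00Theory.
Variables (R : realType) (I : choiceType) (G : archRieszType R).
Implicit Types (f g : c00 I G) (i j : I) (y : G) (s : seq I).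

Lemma c00E f g : (forall i, f i = g i) -> f = g.
Proof. by move=> fg; apply/val_inj/funext. Qed.

Lemma c00_sum_val (J : Type) (s : seq J) (F : J -> c00 I G) i :
  (\sum_(j <- s) F j : c00 I G) i = \sum_(j <- s) F j i.
Proof. by elim: s => [|j s IH]; rewrite ?big_nil// !big_cons -IH. Qed.

Fact c00_single_subproof i y : (fun j => if j == i then y else 0) \in @c00_pred R I G.
Proof.
apply/asboolP; apply: (sub_finite_set (B := [set i]%classic)) => // j /=.
by have [//|_] := eqVneq j i; rewrite eqxx.
Qed.

Definition c00_single i y : c00 I G := C00 (c00_single_subproof i y).

Definition c00_supp f : seq I := fset_set [set i | f i != 0]%classic.

Lemma mem_c00_supp f i : (i \in c00_supp f) = (f i != 0).
Proof.
have fin : finite_set [set i | f i != 0]%classic by case: f => f /= /asboolP.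
by rewrite /c00_supp in_fset_set// mem_setE.
Qed.

Lemma c00_supp_uniq f : uniq (c00_supp f).
Proof. exact: fset_uniq. Qed.

Lemma c00_decomp s f : uniq s -> (forall i, f i != 0 -> i \in s) ->
  f = \sum_(i <- s) c00_single i (f i).
Proof.
move=> us fs; apply: c00E => j; rewrite c00_sum_val /=.
have [js|js] := boolP (j \in s).
  rewrite (bigD1_seq j)//= eqxx big1 ?addr0// => i.
  by rewrite eq_sym => /negbTE->.
rewrite big1_seq => [|i /= si].
  by apply/eqP; move: js; apply: contraNT; exact: fs.
by case: eqP => // ji; move: js; rewrite ji si.
Qed.

Lemma c00_linear_ext (V : lmodType R) (S S' : c00 I G -> V) :
  linear S -> linear S' ->
  (forall i y, S (c00_single i y) = S' (c00_single i y)) -> S =1 S'.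
Proof.
move=> linS linS' SS' f.
pose L : {linear c00 I G -> V} := HB.pack S (GRing.isLinear.Build _ _ _ _ S linS).
pose L' : {linear c00 I G -> V} :=
  HB.pack S' (GRing.isLinear.Build _ _ _ _ S' linS').
rewrite (@c00_decomp (c00_supp f) f) ?c00_supp_uniq// => [|i]; last first.
  by rewrite mem_c00_supp.
rewrite -[LHS]/(L _) -[RHS]/(L' _) !linear_sum.
by apply: eq_bigr => i _; exact: SS'.
Qed.

Section Sum.
Variables (H : rieszType R) (d : I -> G -> H).
Hypothesis homd : forall i, riesz_hom (d i).
Hypothesis disjd : forall i j x y, 0 <= x -> 0 <= y -> i != j ->
  rdisj (d i x) (d j y).

Definition c00_sum f : H := \sum_(i <- c00_supp f) d i (f i).

Lemma c00_sumE s f : uniq s -> (forall i, f i != 0 -> i \in s) ->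
  c00_sum f = \sum_(i <- s) d i (f i).
Proof.
move=> us fs; rewrite (bigID (fun i => f i != 0))/= addrC big1 ?add0r; last first.
  by move=> i; rewrite negbK => /eqP->; exact: riesz_hom0.
rewrite -big_filter; apply: perm_big; apply: uniq_perm.
- exact: c00_supp_uniq.
- exact: filter_uniq.
- move=> i; rewrite mem_filter mem_c00_supp.
  by case: (boolP (f i == 0)) => //= /fs.
Qed.

Lemma c00_sum_single i y : c00_sum (c00_single i y) = d i y.
Proof.
rewrite (@c00_sumE [:: i])//= ?big_seq1/= ?eqxx// => j.
by rewrite inE; case: (j == i) => //; rewrite eqxx.
Qed.

(** For disjoint [f] and [g] all terms of the two sums are disjoint: at equal indices because [d i]
    is a homomorphism, at different ones by [disjd]. *)
Lemma c00_sum_hom : riesz_hom c00_sum.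
Proof.
apply: riesz_hom_criterion => [a f g|f g fg].
  pose s := undup (c00_supp f ++ c00_supp g).
  have us : uniq s by exact: undup_uniq.
  have fs i : f i != 0 -> i \in s by rewrite mem_undup mem_cat mem_c00_supp => ->.
  have gs i : g i != 0 -> i \in s.
    by rewrite mem_undup mem_cat !mem_c00_supp orbC => ->.
  rewrite (c00_sumE us fs) (c00_sumE us gs) (@c00_sumE s)//; last first.
    move=> i; apply: contraNT => nis.
    have -> : (a *: f + g) i = a *: f i + g i by [].
    have [/eqP->|/fs] := boolP (f i == 0); last by rewrite (negbTE nis).
    have [/eqP->|/gs] := boolP (g i == 0); last by rewrite (negbTE nis).
    by rewrite scaler0 addr0.
  rewrite scaler_sumr -big_split; apply: eq_bigr => i _ /=.
  by have [-> _ _] := homd i.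
have fgi i : rdisj (f i) (g i) := congr1 (fun h : c00 I G => h i) fg.
have f0 i : 0 <= f i by rewrite -(fgi i) leIl.
have g0 i : 0 <= g i by rewrite -(fgi i) leIr.
have df0 i : 0 <= d i (f i) by exact: riesz_hom_ge0.
have dg0 i : 0 <= d i (g i) by exact: riesz_hom_ge0.
apply: rdisj_sum => //; first exact: rz_sum_ge0.
move=> i; apply: rdisjC; apply: rdisj_sum => // j; apply: rdisjC.
have [->|ij] := eqVneq i j; last exact: disjd.
exact: riesz_hom_disj.
Qed.

Lemma c00_sum_inj : (forall i y, 0 <= y -> d i y = 0 -> y = 0) ->
  injective c00_sum.
Proof.
move=> dinj; apply: riesz_hom_inj => [|f /c00_leP f0 Sf]; first exact: c00_sum_hom.
apply: c00E => i; apply: (dinj i) => //; first exact: f0.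
apply: le_anti; rewrite (riesz_hom_ge0 (homd i)) ?andbT; last exact: f0.
rewrite -c00_sum_single -Sf; apply: (riesz_hom_le c00_sum_hom).
by apply/c00_leP => j /=; case: eqP => [->|_]//; exact: f0.
Qed.

End Sum.

(** Suprema are taken pointwise. The support stays finite because the supremum vanishes wherever a
    member [f0] and an upper bound [g] both do. *)
Lemma c00_dedekind_complete : dedekind_complete G -> dedekind_complete (c00 I G).
Proof.
move=> dcG A [[f0 Af0] [g gA]].
have /choice[h hP] i : exists z, supremums (fun z => exists2 f, A f & z = f i) z.
  apply: dcG; split; first by exists (f0 i), f0.
  by exists (g i) => z [f /gA/c00_leP h ->].
have hfin : h \in @c00_pred R I G.
  have := c00_sub (f := f0) (g := g) (h := h); apply=> [i fi gi||].
  - apply: le_anti; apply/andP; split.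
      by apply: (hP i).2 => z [f /gA/c00_leP/(_ i)]; rewrite gi => ? ->.
    by rewrite -fi; apply: (hP i).1; exists f0.
  - by case: (f0).
  - by case: (g).
exists (C00 hfin); split=> [f Af|u uA]; apply/c00_leP => i /=.
  by apply: (hP i).1; exists f.
by apply: (hP i).2 => z [f /uA/c00_leP/(_ i) fu ->].
Qed.

End C00Theory.

(** * Riesz isomorphisms *)

Section RieszIso.
Variable R : realType.
Implicit Types E F G : rieszType R.

Lemma riesz_hom_inv E F (f : E -> F) (g : F -> E) :
  cancel f g -> cancel g f -> riesz_hom f -> riesz_hom g.
Proof.
move=> fK gK [linf mf jf].
split=> [a x y|x y|x y]; rewrite -[LHS]fK -[RHS]fK; congr g.
- by rewrite linf !gK.
- by rewrite mf !gK.
- by rewrite jf !gK.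
Qed.

Lemma riesz_iso_sym E F : E ≅ F -> F ≅ E.
Proof.
move=> [f [homf [g fK gK]]]; exists g; split; last by exists f.
exact: riesz_hom_inv homf.
Qed.

Lemma riesz_iso_trans E F G : E ≅ F -> F ≅ G -> E ≅ G.
Proof.
move=> [f [homf bijf]] [g [homg bijg]]; exists (g \o f); split.
  exact: riesz_hom_comp.
exact: bij_comp.
Qed.

Lemma riesz_iso_dedekind_complete E F :
  E ≅ F -> dedekind_complete E -> dedekind_complete F.
Proof.
move=> [f [homf [g fK gK]]] dcE A [[a0 Aa0] [b bA]].
have homg : riesz_hom g by exact: riesz_hom_inv homf.
have [] := dcE (fun x => A (f x)).
  split; first by exists (g a0); rewrite /= gK.
  by exists (g b) => x /bA /(riesz_hom_le homg); rewrite fK.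
move=> s [sA As]; exists (f s); split=> [x Ax|u uA].
  by rewrite -[x]gK; apply: (riesz_hom_le homf); apply: sA; rewrite /= gK.
rewrite -[u]gK; apply: (riesz_hom_le homf); apply: As => x /uA.
by move=> /(riesz_hom_le homg); rewrite fK.
Qed.

End RieszIso.

Lemma scale_vec_hom (R : realType) (E : rieszType R) (y : E) :
  0 <= y -> riesz_hom (fun r : R^o => r *: y).
Proof.
move=> y0; apply: riesz_hom_criterion => [a u v|u v uv].
  by rewrite scalerDl -scalerA.
have min0 : Num.min u v = 0 by exact: uv.
have : 0 <= Num.min u v by rewrite min0.
rewrite le_min => /andP[u0 v0]; move: min0; rewrite minEle.
case: ifP => _ ->; rewrite scale0r.
  by apply/meet_idPl; exact: rz_scale_ge0.
by apply/meet_idPr; exact: rz_scale_ge0.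
Qed.

Lemma scale_hom (R : realType) (E : rieszType R) (a : R) :
  0 <= a -> riesz_hom (fun y : E => a *: y).
Proof.
move=> a0; apply: riesz_hom_criterion => [b u v|u v uv].
  by rewrite scalerDr !scalerA mulrC.
by rewrite /rdisj -rz_scalemeet// uv scaler0.
Qed.

Lemma linear_scale (R : realType) (V W : lmodType R) (f : V -> W) (a : R)
    (x : V) :
  linear f -> f (a *: x) = a *: f x.
Proof.
move=> linf.
pose L : {linear V -> W} := HB.pack f (GRing.isLinear.Build _ _ _ _ f linf).
by rewrite -[LHS]/(L _) linearZ.
Qed.

(** * The tensor product of c00(I) with F *)

Section C00Tensor.
Variables (R : realType) (E F : archRieszType R) (I : choiceType).
Variables (h : E -> c00 I R^o) (k : c00 I R^o -> E).
Hypotheses (homh : riesz_hom h) (hK : cancel h k) (kK : cancel k h).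

Fact c00_tens_subproof x y : (fun i => h x i *: y) \in @c00_pred R I F.
Proof.
apply/asboolP; case: (h x) => f /= /asboolP; apply: sub_finite_set => i /=.
by apply: contra_neq => ->; rewrite scale0r.
Qed.

Definition c00_tens x y : c00 I F := C00 (c00_tens_subproof x y).

Lemma c00_hom (E' : rieszType R) (G : archRieszType R) (J : Type)
    (T : E' -> c00 J G) :
  (forall j, riesz_hom (fun x => T x j)) -> riesz_hom T.
Proof.
move=> homT; split=> [a x y|x y|x y]; apply/val_inj/funext => j.
- by have [l _ _] := homT j; exact: l.
- by have [_ m _] := homT j; exact: m.
- by have [_ _ l] := homT j; exact: l.
Qed.

Lemma c00_eval_hom (G : archRieszType R) (J : Type) (j : J) :
  riesz_hom (fun f : c00 J G => f j).
Proof. by split. Qed.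

Fact c00_tens_bimorphism : riesz_bimorphism c00_tens.
Proof.
have [linh _ _] := homh.
split=> [y a x x'|x a y y'|y y0|x x0].
- apply: c00E => i /=; rewrite linh -[LHS]/((a * h x i + h x' i) *: y).
  by rewrite scalerDl -scalerA.
- by apply: c00E => i /=; rewrite scalerDr !scalerA mulrC -scalerA.
- apply: c00_hom => i; apply: (riesz_hom_comp (scale_vec_hom y0)).
  exact: (riesz_hom_comp (c00_eval_hom _ i) homh).
- apply: c00_hom => i; apply: scale_hom.
  by have /c00_leP := riesz_hom_ge0 homh x0; exact.
Qed.

Section Universal.
Variables (H : archRieszType R) (psi : E -> F -> H).
Hypothesis bimpsi : riesz_bimorphism psi.

Let delta i : E := k (c00_single i (1 : R^o)).

Let homk : riesz_hom k := riesz_hom_inv hK kK homh.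

Let delta_ge0 i : 0 <= delta i.
Proof.
apply: (riesz_hom_ge0 homk); apply/c00_leP => j /=.
by case: eqP => _ //; exact: ler01.
Qed.

Let delta_disj i j : i != j -> rdisj (delta i) (delta j).
Proof.
move=> ij; apply: (riesz_hom_disj homk); apply: c00E => l.
rewrite -[LHS]/(Num.min _ _) /=.
have [->|li] := eqVneq l i.
  by rewrite (negbTE ij); apply/min_idPr; exact: ler01.
by case: (l == j); apply/min_idPl => //; exact: ler01.
Qed.

Lemma c00_singleZ (i : I) (r : R^o) : c00_single i r = r *: c00_single i (1 : R^o).
Proof.
apply: c00E => j; rewrite -[RHS]/(r * (if j == i then 1 else 0)) /=.
by case: (j == i); rewrite ?mulr1 ?mulr0.
Qed.

Lemma c00_tens_delta i y : c00_tens (delta i) y = c00_single i y.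
Proof.
apply: c00E => j /=; rewrite kK /=; case: (j == i); first exact: scale1r.
exact: scale0r.
Qed.

(** Every [f] is a finite sum of the tensors of [delta i] with [f i], so [T] has to be [c00_sum] of
    the maps [psi (delta i)]. This is a homomorphism since the [delta i] are disjoint. *)
Fact c00_tens_universal : exists! T : c00 I F -> H,
  riesz_hom T /\ forall x y, T (c00_tens x y) = psi x y.
Proof.
have [linl linr homl homr] := bimpsi.
pose d i := psi (delta i).
have homd i : riesz_hom (d i) by exact: homr.
have disjd i j y z : 0 <= y -> 0 <= z -> i != j -> rdisj (d i y) (d j z).
  by move=> y0 z0 ij; apply: (bimorphism_disjl bimpsi) => //; exact: delta_disj.
have homS : riesz_hom (c00_sum d) by exact: c00_sum_hom.
exists (c00_sum d); split.
  split=> // x y; rewrite -(hK x); move: (h x) => u.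
  have [bl _ _ _] := c00_tens_bimorphism.
  (* Both sides are linear in [u], so functions supported at one point suffice. *)
  apply: (c00_linear_ext (S := fun u => c00_sum d (c00_tens (k u) y))
    (S' := fun u => psi (k u) y)) => [a v w|a v w|i r].
  - have [linS _ _] := homS; have [link _ _] := homk.
    by rewrite link bl linS.
  - by have [link _ _] := homk; rewrite link linl.
  - have -> : c00_tens (k (c00_single i r)) y = c00_single i (r *: y).
      apply: c00E => j /=; rewrite kK /=; case: (j == i) => //.
      exact: scale0r.
    rewrite c00_sum_single// (riesz_homZ (homd i)) c00_singleZ (riesz_homZ homk).
    by rewrite (linear_scale _ _ (linl y)).
move=> T [homT Tpsi]; apply/funext => f.
apply: c00_linear_ext f => [||i y]; first by case: homS.
  by case: homT.
by rewrite c00_sum_single// -c00_tens_delta Tpsi.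
Qed.

End Universal.

Lemma tensor_c00 : E ⊗ F ≅ c00 I F.
Proof.
exact: (fremlin_tensor_unique (fremlin E F)
  (FremlinTensor c00_tens_bimorphism c00_tens_universal)).
Qed.

End C00Tensor.

Section TensorSwap.
Variables (R : realType) (E F : archRieszType R) (T : fremlin_tensor F E).

Definition swap_tens (x : E) (y : F) : T := ft_tens T y x.

Lemma bimorphism_swap (G E' F' : rieszType R) (psi : E' -> F' -> G) :
  riesz_bimorphism psi -> riesz_bimorphism (fun y x => psi x y).
Proof. by case. Qed.

Fact swap_universal (H : archRieszType R) (psi : E -> F -> H) :
  riesz_bimorphism psi ->
  exists! S : T -> H, riesz_hom S /\ forall x y, S (swap_tens x y) = psi x y.
Proof.
move=> /bimorphism_swap/(ft_universal T)[S [[homS Spsi] uS]].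
exists S; split; first by split=> // x y; exact: Spsi.
by move=> S' [homS' S'psi]; apply: uS; split=> // y x; exact: S'psi.
Qed.

Definition fremlin_swap : fremlin_tensor E F :=
  FremlinTensor (bimorphism_swap (ft_bimorphism T)) swap_universal.

End TensorSwap.

Lemma tensor_swap (R : realType) (E F : archRieszType R) : E ⊗ F ≅ F ⊗ E.
Proof.
exact: (fremlin_tensor_unique (fremlin E F) (fremlin_swap (fremlin F E))).
Qed.

Lemma tensor_c00l (R : realType) (E F : archRieszType R) (I : choiceType) :
  E ≅ c00 I R^o -> E ⊗ F ≅ c00 I F.
Proof. by move=> [h [homh [k hK kK]]]; exact: tensor_c00 homh hK kK. Qed.

Lemma tensor_c00r (R : realType) (E F : archRieszType R) (J : choiceType) :
  F ≅ c00 J R^o -> E ⊗ F ≅ c00 J E.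
Proof.
by move=> FJ; apply: riesz_iso_trans (tensor_swap E F) _; exact: tensor_c00l.
Qed.

(** * Spaces without infinite bounded disjoint sequences *)

Section Discrete.
Variables (R : realType) (E : archRieszType R).

(** [a ∧ b] is a multiple of both atoms. If either coefficient is nonpositive the atoms are
    disjoint; otherwise they are proportional. *)
Lemma atoms_disj (a b : E) : atom a -> atom b ->
  rdisj a b \/ exists2 c : R, 0 < c & a = c *: b.
Proof.
move=> [/ltW a0' aa] [/ltW b0' ab]; have ab0 : 0 <= Order.meet a b by rewrite lexI a0'.
have [c ca] := aa _ ab0 (leIl _ _); have [d db] := ab _ ab0 (leIr _ _).
have [d0|d0] := ltP 0 d; last first.
  by left; apply: (le_rdisj a0' b0'); rewrite db -(scale0r b) rz_leZr.
have [c0|c0] := ltP 0 c; last first.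
  by left; apply: (le_rdisj a0' b0'); rewrite ca -(scale0r a) rz_leZr.
right; exists (c^-1 * d); first by rewrite mulr_gt0 ?invr_gt0.
by rewrite -scalerA -db ca scalerA mulVf ?gt_eqF// scale1r.
Qed.

Definition atom_class (a : E) : set E :=
  fun b => atom b /\ exists2 c : R, 0 < c & b = c *: a.

(** The choice depends only on the class, so the fixed points of [atom_repr] among the atoms contain
    one atom from each class. *)
Definition atom_repr (a : E) : E := xget 0 (atom_class a).

Lemma atom_reprP a : atom a -> atom_class a (atom_repr a).
Proof.
move=> aa; apply: (xgetPex 0); exists a; split=> //.
by exists 1; rewrite ?ltr01// scale1r.
Qed.

Lemma atom_repr_scale (a b : E) (c : R) : 0 < c -> b = c *: a ->
  atom_repr b = atom_repr a.
Proof.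
move=> c0 ->; congr (xget 0 _); apply/funext => z; apply/propext.
split=> -[az [d d0 zE]]; split=> //; rewrite zE.
  by exists (d * c); rewrite ?mulr_gt0// scalerA.
by exists (d / c); rewrite ?divr_gt0// scalerA divfK// gt_eqF.
Qed.

Lemma discrete_iso : no_disjoint_seq E -> exists I : set E, E ≅ c00 I R^o.
Proof.
move=> nds; pose I : set E := fun a => atom a /\ atom_repr a = a.
exists I; apply: riesz_iso_sym.
have atomI (i : I) : atom (val i) by have := set_valP i; case.
have I0 (i : I) : 0 <= val i by apply: ltW; case: (atomI i).
pose d (i : I) (r : R^o) := r *: val i.
have homd i : riesz_hom (d i) by exact: scale_vec_hom.
have disjd (i j : I) (x y : R^o) : 0 <= x -> 0 <= y -> i != j ->
    rdisj (d i x) (d j y).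
  move=> x0 y0 ij; apply: rdisj_scale => //.
  have [//|[c c0 cij]] := atoms_disj (atomI i) (atomI j).
  have [_ ri] := set_valP i; have [_ rj] := set_valP j.
  case/eqP: ij; apply: val_inj; rewrite /= -[LHS]ri -[RHS]rj.
  exact: atom_repr_scale cij.
have homS := c00_sum_hom homd disjd.
exists (c00_sum d); split=> //.
have injS : injective (c00_sum d).
  apply: c00_sum_inj => // i y _ /eqP; rewrite scaler_eq0 => /orP[/eqP//|].
  by have [] := atomI i; rewrite lt_neqAle eq_sym => /andP[/negbTE->].
have surjS x : exists f, c00_sum d f = x.
  have [linS _ _] := homS.
  have pos : forall z : E, 0 <= z -> exists f, c00_sum d f = z.
    apply: (@atoms_ind _ _ (fun z => exists f, c00_sum d f = z)) => //.
      by exists 0; exact: riesz_hom0.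
    move=> c a y aa [f <-].
    have [ra [e e0 ea]] := atom_reprP aa.
    have rI : I (atom_repr a) by split=> //; exact: atom_repr_scale ea.
    (* The representative is [e a], so [c a] is its multiple by [c / e]. *)
    exists (c / e *: c00_single (SigSub (mem_set rI)) (1 : R^o) + f).
    rewrite linS c00_sum_single// /d /= scale1r ea scalerA divfK//.
    by rewrite gt_eqF.
  have [f fx] := pos _ (rpos_ge0 x); have [g gx] := pos _ (rpos_ge0 (- x)).
  by exists (f - g); rewrite (riesz_homB homS) fx gx rposB.
have /choice[g gK] := surjS.
by exists g => // f; apply: injS; rewrite gK.
Qed.

(** Nonzero disjoint positive elements are linearly independent, by injectivity of [c00_sum]; but
    [n + 1] vectors in dimension [n] satisfy a nontrivial relation. *)
Lemma finite_dimensional_no_disjoint_seq :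
  finite_dimensional E -> no_disjoint_seq E.
Proof.
move=> [n [[v2r linv bijv]]] x e [e0 _ ed].
have e0' i := ltW (e0 i).
pose d (i : nat) (r : R^o) := r *: e i.
have homd i : riesz_hom (d i) by exact: scale_vec_hom.
have disjd i j (y z : R^o) : 0 <= y -> 0 <= z -> i != j -> rdisj (d i y) (d j z).
  by move=> y0 z0 /ed; exact: rdisj_scale.
have homS := c00_sum_hom homd disjd.
have injS : injective (c00_sum d).
  apply: c00_sum_inj => // i y _ /eqP; rewrite scaler_eq0 => /orP[/eqP//|].
  by have := e0 i; rewrite lt_neqAle eq_sym => /andP[/negbTE->].
pose L : {linear E -> 'rV[R]_n} := HB.pack v2r (GRing.isLinear.Build _ _ _ _ v2r linv).
pose M := \matrix_(i < n.+1) L (e i).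
have [u /negP u0 /sub_kermxP uM] :
    exists2 u : 'rV_n.+1, ~~ (u == 0) & (u <= kermx M)%MS.
  have /rowV0Pn[u uk u0] : kermx M != 0.
    by rewrite -mxrank_eq0 mxrank_ker subn_eq0 -ltnNge ltnS rank_leq_col.
  by exists u.
apply: u0; pose f := \sum_(i < n.+1) c00_single (val i) (u 0 i : R^o) : c00 nat R^o.
have Sf : c00_sum d f = 0.
  have [S SE] := riesz_hom_linear homS.
  rewrite SE linear_sum -SE; apply: (bij_inj bijv).
  rewrite -[LHS]/(L _) -[RHS]/(L _) linear0 -uM mulmx_sum_row linear_sum.
  apply: eq_bigr => i _; rewrite c00_sum_single// rowK -linearZ//.
have f0 : f = 0 by apply: injS; rewrite Sf (riesz_hom0 homS).
apply/eqP/rowP => i; rewrite mxE.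
have : f (val i) = 0 by rewrite f0.
rewrite /f c00_sum_val (bigD1 i)//= eqxx big1 ?addr0// => j ji.
by rewrite eq_sym (inj_eq val_inj) (negbTE ji).
Qed.

End Discrete.

Lemma c00_finite_dimensional (R : realType) (V : rieszType R) (I : choiceType)
    (h : V -> c00 I R^o) (s : seq I) :
  riesz_hom h -> bijective h -> uniq s ->
  (forall v i, h v i != 0 -> i \in s) -> finite_dimensional V.
Proof.
move=> homh [k hK kK] us hs; exists (size s).
pose v2r v : 'rV[R]_(size s) := \row_j h v (tnth (in_tuple s) j).
pose r2v (r : 'rV[R]_(size s)) :=
  k (\sum_j c00_single (tnth (in_tuple s) j) (r 0 j : R^o)).
constructor; exists v2r.
  by move=> a u v; apply/rowP => j; rewrite !mxE; have [-> _ _] := homh.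
exists r2v => [v|r].
  rewrite /r2v -[RHS]hK; congr k.
  rewrite [RHS](c00_decomp us (hs v)) [RHS]big_tnth.
  by apply: eq_bigr => j _; rewrite mxE.
apply/rowP => j; rewrite mxE kK c00_sum_val (bigD1 j)//= eqxx big1 ?addr0//.
move=> i ij; case: eqP => // /(tuple_uniqP (in_tuple s) us) ji.
by rewrite ji eqxx in ij.
Qed.

(** * Principal ideals *)

Lemma rabs_id (R : realType) (E : rieszType R) (x : E) : 0 <= x -> rabs x = x.
Proof.
move=> x0; apply: le_anti; rewrite leUx lexx leUl /= andbT.
by apply: (le_trans _ x0); rewrite -oppr0 rz_leN.
Qed.

Section Pideal.
Variables (R : realType) (E : archRieszType R) (x : E).

Lemma pideal_between (a b y : E) :
  a \in pideal_pred x -> b \in pideal_pred x -> a <= y -> y <= b ->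
  y \in pideal_pred x.
Proof.
move=> ax bx ay yb; have [z [[l l0 zE] [_ za] [bz _]]] := pideal_bound ax bx.
apply/asboolP; exists l => //; rewrite -zE; apply/rabs_leP.
by split; [exact: le_trans bz|exact: le_trans ay].
Qed.

Lemma pideal_dedekind_complete : dedekind_complete E -> dedekind_complete (pideal x).
Proof.
move=> dcE A [[a Aa] [b bA]].
have [] := dcE (fun z => exists2 u : pideal x, A u & z = val u).
  split; first by exists (val a), a.
  by exists (val b) => z [u Au ->]; exact: bA.
move=> s [sA As].
have as_ : val a <= s by apply: sA; exists a.
have sb : s <= val b by apply: As => z [u Au ->]; exact: bA.
exists (PIdeal (pideal_between (valP a) (valP b) as_ sb)); split.
  by move=> u Au; apply: sA; exists u.
by move=> u uA; apply: As => z [w Aw ->]; exact: uA.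
Qed.

Lemma pideal_no_disjoint_seq : no_disjoint_seq E -> no_disjoint_seq (pideal x).
Proof.
move=> nds z e [e0 ez ed]; apply: (nds (val z) (fun n => val (e n))).
by split=> // m n /ed/(congr1 val).
Qed.

Hypothesis x0 : 0 <= x.

Lemma pideal_unit_subproof (y : E) : 0 <= y -> y <= x -> y \in pideal_pred x.
Proof.
by move=> y0 yx; apply/asboolP; exists 1; rewrite ?ler01// scale1r !rabs_id.
Qed.

Definition pideal_unit : pideal x := PIdeal (pideal_unit_subproof x0 (lexx x)).

Lemma pideal_disjoint_seq (e : nat -> E) : disjoint_seq x e ->
  exists e' : nat -> pideal x, disjoint_seq pideal_unit e'.
Proof.
move=> [e0 ex ed].
exists (fun n => PIdeal (pideal_unit_subproof (ltW (e0 n)) (ex n))).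
by split=> // m n /ed emn; apply: val_inj.
Qed.

(** Every element lies between two multiples of the order unit [x], so its image in [c00 I] is
    supported in the finite support of the image of [x]. *)
Lemma pideal_finite_dimensional :
  no_disjoint_seq (pideal x) -> finite_dimensional (pideal x).
Proof.
move=> /discrete_iso[I [h [homh bijh]]].
apply: (c00_finite_dimensional homh bijh (c00_supp_uniq (h pideal_unit))).
move=> v i; rewrite mem_c00_supp; apply: contraNN => /eqP hi.
have /asboolP[l l0] := valP v; rewrite [rabs x]rabs_id// => /rabs_leP[vl lv].
have {}vl : v <= l *: pideal_unit by [].
have {}lv : - (l *: pideal_unit) <= v by [].
have /c00_leP/(_ i) := riesz_hom_le homh vl.
have /c00_leP/(_ i) := riesz_hom_le homh lv.
rewrite -scaleNr !(riesz_homZ homh).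
have e c : (c *: h pideal_unit) i = 0.
  by rewrite -[LHS]/(c * h pideal_unit i) hi mulr0.
by rewrite !e => h1 h2; apply/eqP/le_anti; rewrite h1 h2.
Qed.

End Pideal.

Lemma finite_dimensional_pidealsP (R : realType) (E : archRieszType R) :
  (forall x : E, 0 <= x -> finite_dimensional (pideal x)) <-> no_disjoint_seq E.
Proof.
split=> [fd x e ds|nds x x0]; last first.
  exact/pideal_finite_dimensional/pideal_no_disjoint_seq.
have x0 : 0 <= x by case: ds => e0 ex _; exact: le_trans (ltW (e0 0%N)) (ex _).
have [e' ds'] := pideal_disjoint_seq x0 ds.
exact: finite_dimensional_no_disjoint_seq (fd _ x0) _ _ ds'.
Qed.

(** * The cycle of implications *)

Lemma dedekind_complete_tensor (R : realType) (E F : archRieszType R) :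
  dedekind_complete (E ⊗ F) -> no_disjoint_seq E \/ no_disjoint_seq F.
Proof.
move=> dc; apply: contrapT => /not_orP[nE nF]; apply: nE => x e de.
by apply: nF => y f df; exact: tensor_not_dedekind_complete de df dc.
Qed.

Theorem corollary4p7 (R : realType) (E F : archRieszType R)
    (dcE : dedekind_complete E) (dcF : dedekind_complete F) :
  [<-> forall (x : E) (y : F), 0 <= x -> 0 <= y ->
         dedekind_complete (pideal x ⊗ pideal y) ;
       (forall x : E, 0 <= x -> finite_dimensional (pideal x)) \/
         (forall y : F, 0 <= y -> finite_dimensional (pideal y)) ;
       (exists I : set E, E ≅ c00 I R^o) \/
         (exists J : set F, F ≅ c00 J R^o) ;
       (exists I : set E, E ⊗ F ≅ c00 I F) \/
         (exists J : set F, E ⊗ F ≅ c00 J E) ;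
       dedekind_complete (E ⊗ F) ].
Proof.
tfae.
(* Disjoint sequences bounded by [x] and [y] live in the two principal ideals, whose tensor product
   then fails to be Dedekind complete. *)
- move=> dc; rewrite !finite_dimensional_pidealsP.
  apply: contrapT => /not_orP[nE nF]; apply: nE => x e de.
  apply: nF => y f df.
  have x0 : 0 <= x by case: de => e0 ex _; exact: le_trans (ltW (e0 0%N)) (ex _).
  have y0 : 0 <= y by case: df => f0 fy _; exact: le_trans (ltW (f0 0%N)) (fy _).
  have [e' de'] := pideal_disjoint_seq x0 de.
  have [f' df'] := pideal_disjoint_seq y0 df.
  exact: tensor_not_dedekind_complete de' df' (dc _ _ x0 y0).
- rewrite !finite_dimensional_pidealsP => -[] nds; [left|right];
    exact: discrete_iso.
- move=> [[I EI]|[J FJ]]; [left; exists I|right; exists J].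
    exact: tensor_c00l.
  exact: tensor_c00r.
- move=> [[I EFI]|[J EFJ]].
    exact: riesz_iso_dedekind_complete (riesz_iso_sym EFI)
      (c00_dedekind_complete dcF).
  exact: riesz_iso_dedekind_complete (riesz_iso_sym EFJ)
    (c00_dedekind_complete dcE).
(* The absence of disjoint sequences passes to a principal ideal, which is thus some [c00 I]; the
   tensor product is [c00 I] over the other ideal, itself Dedekind complete. *)
- move=> /dedekind_complete_tensor[] nds x y x0 y0.
    have [I /(tensor_c00l (pideal y))/riesz_iso_sym iso] :=
      discrete_iso (pideal_no_disjoint_seq (x := x) nds).
    apply: riesz_iso_dedekind_complete iso _.
    exact/c00_dedekind_complete/pideal_dedekind_complete.
  have [I /(tensor_c00r (pideal x))/riesz_iso_sym iso] :=
    discrete_iso (pideal_no_disjoint_seq (x := y) nds).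
  apply: riesz_iso_dedekind_complete iso _.
  exact/c00_dedekind_complete/pideal_dedekind_complete.
Qed.
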